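(* Let $\phi(w)=aw+b$ with $a>0$ and $b\in\mathbb{C}$, $\mathrm{Re}(b)\geq 0$, and let $C_\phi f=f\circ\phi$ on $H^2(\mathbb{C}_{+})$. (S.1) If either $a\neq 1$ and $\mathrm{Re}(b)=0$ (hyperbolic automorphism), or $a\in(1,\infty)$ and $\mathrm{Re}(b)>0$ (hyperbolic non-automorphism of type II), then $C_{\phi}$ has the positive shadowing property on $H^2(\mathbb{C}_{+})$. (S.2) If either $a=1$ (parabolic type), or $a\in(0,1)$ and $\mathrm{Re}(b)>0$ (hyperbolic non-automorphism of type I), then $C_{\phi}$ does not have the positive shadowing property on $H^2(\mathbb{C}_{+})$.
   Context: $\mathbb{C}_{+}=\{w\in\mathbb{C}:\mathrm{Re}(w)>0\}$. $H^2(\mathbb{C}_{+})$ is the Hardy space of holomorphic $f$ on $\mathbb{C}_{+}$ with finite norm $\|f\|_2^2=\sup_{0<x<\infty}\frac{1}{\pi}\int_{-\infty}^{\infty}|f(x+iy)|^2\,dy$; $C_\phi$ is bounded on it. For an operator $T$ on a Banach space $X$ and $\delta>0$, a sequence $(x_n)_{n\in\mathbb{N}}\subset X$ is a $\delta$-pseudotrajectory if $\|Tx_n-x_{n+1}\|\le\delta$ for all $n$. $T$ has the positive shadowing property if for every $\epsilon>0$ there is $\delta>0$ such that for every $\delta$-pseudotrajectory $(x_n)_{n\in\mathbb{N}}$ there exists $x\in X$ with $\|T^nx-x_n\|\le\epsilon$ for all $n\in\mathbb{N}$. *)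

(* Defs.v *)
From Stdlib Require Import Reals.
From Coquelicot Require Import Coquelicot.
Open Scope R_scope.

Definition holomorphic_on_Cplus (f : C -> C) : Prop :=
  forall w : C, 0 < Re w -> @ex_derive C_AbsRing C_NormedModule f w.

(* ||f||_2^2 = sup_{x>0} (1/pi) \int_{-oo}^{oo} |f(x+iy)|^2 dy.  Since the integrand
   is nonnegative, the improper integral is the sup over T of the integral over
   [-T,T]; so ||f||_2^2 is the (extended-real) sup over x>0 and T. *)
Definition h2_normsq (f : C -> C) : Rbar :=
  Lub_Rbar (fun r : R => exists x T : R, 0 < x /\
     r = / PI * RInt (fun y : R => (Cmod (f (x, y))) ^ 2) (- T) T).

Definition h2_norm (f : C -> C) : Rbar :=
  match h2_normsq f with
  | Finite r => Finite (sqrt r)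
  | e => e
  end.

Definition in_H2 (f : C -> C) : Prop :=
  holomorphic_on_Cplus f /\ is_finite (h2_normsq f).

Definition phi_aff (a : R) (b : C) (w : C) : C := Cplus (Cmult (RtoC a) w) b.
Definition Ccomp (a : R) (b : C) (f : C -> C) : C -> C := fun w => f (phi_aff a b w).

Definition H2_positive_shadowing (T : (C -> C) -> (C -> C)) : Prop :=
  forall eps : R, 0 < eps -> exists delta : R, 0 < delta /\
    forall xs : nat -> (C -> C),
      (forall n, in_H2 (xs n)) ->
      (forall n, Rbar_le (h2_norm (fun w => Cminus (T (xs n) w) (xs (S n) w)))
                         (Finite delta)) ->
      exists x : C -> C, in_H2 x /\
        forall n, Rbar_le (h2_norm (fun w => Cminus (Nat.iter n T x w) (xs n w)))
                          (Finite eps).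

(* Main.v *)
Require Import Defs.
From Stdlib Require Import Reals Lra Lia ClassicalEpsilon.
From Coquelicot Require Import Coquelicot.
Open Scope R_scope.

(** Since [||f o phi|| <= a^(-1/2) ||f||], with equality when [Re b = 0], the operator is
    a contraction for [a > 1], and [x = x_0] shadows.  For [a < 1], [Re b = 0] its inverse
    is a contraction, and [x = lim T^-n x_n] shadows; the limit exists because H^2 is
    complete, which rests on the bound of [|f z|] and [|f' z|] by [||f||] on half-planes
    [Re z >= rho > 0], obtained from Goursat's theorem.  For [a = 1] the pseudotrajectory
    [n delta T^n f], [f w = 1 / (w + 1)], is unbounded while every orbit is bounded.  For
    [a < 1], [Re b > 0], [T] preserves the value at the fixed point of [phi] in the open
    half-plane, so the pseudotrajectory [delta * sum_(k < n) T^k f] drifts away from every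
    orbit near that point. *)

(** * Complex derivatives and integrals of complex paths *)

(** Elements of [H^2] are actual functions and the norm is a supremum of integrals over vertical
    segments, so the whole argument runs on inequalities over such segments. The obstacle is the
    expanding case: the shadowing point has to be produced as a function. It is a pointwise limit,
    and its derivative is the limit of the derivatives; this is why values and derivatives must be
    controlled by the norm, uniformly on half-planes. The thresholds in both positive cases come
    from the recursion [e -> q * e + delta] for the error, where [q < 1] is the norm of the
    contracting operator: [delta = eps * (1 - q)] makes [eps] its fixed point. In the negative cases
    the errors are never damped. For an interior fixed point, evaluation there is a functional
    invariant under [T], so errors of one sign add up. For [a = 1], [T^n f] is of size about [1 / n]
    on a segment of length about [n], so the factor [n] beats its decay. *)

Definition cderiv (f : C -> C) (w l : C) : Prop :=
  forall eps : R, 0 < eps -> exists d : R, 0 < d /\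
    forall z : C, Cmod (z - w) < d ->
      Cmod (f z - f w - l * (z - w)) <= eps * Cmod (z - w).

Definition ccont (f : C -> C) (w : C) : Prop :=
  forall eps : R, 0 < eps -> exists d : R, 0 < d /\
    forall z : C, Cmod (z - w) < d -> Cmod (f z - f w) < eps.

Lemma is_derive_iff_cderiv (f : C -> C) (w l : C) :
  @is_derive C_AbsRing C_NormedModule f w l <-> cderiv f w l.
Proof.
  split.
  - intros [_ H] eps Heps.
    specialize (H w (fun P HP => HP) (mkposreal eps Heps)).
    destruct H as [d Hd].
    exists d; split; [apply cond_pos |].
    intros z Hz. specialize (Hd z Hz). simpl in Hd.
    change (Cmod (f z - f w - (z - w) * l)%C <= eps * Cmod (z - w)%C) in Hd.
    replace (l * (z - w))%C with ((z - w) * l)%C by ring. exact Hd.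
  - intros H. split; [apply is_linear_scal_l |].
    intros x Hx.
    assert (E : w = x)
      by (apply (@is_filter_lim_locally_unique C_AbsRing (AbsRing_NormedModule C_AbsRing)); exact Hx).
    subst x.
    intros eps. destruct (H eps (cond_pos eps)) as [d [Hd1 Hd2]].
    exists (mkposreal d Hd1). intros z Hz.
    change (Cmod (f z - f w - (z - w) * l)%C <= eps * Cmod (z - w)%C).
    replace ((z - w) * l)%C with (l * (z - w))%C by ring. apply Hd2. exact Hz.
Qed.

Lemma cderiv_ccont (f : C -> C) (w l : C) : cderiv f w l -> ccont f w.
Proof.
  intros H eps Heps. destruct (H 1 Rlt_0_1) as [d [Hd1 Hd2]].
  pose proof (Cmod_ge_0 l) as Hl.
  exists (Rmin d (eps / (2 + Cmod l))). split.
  { apply Rmin_pos; [lra |]. apply Rdiv_lt_0_compat; lra. }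
  intros z Hz.
  assert (Hz1 : Cmod (z - w) < d) by (eapply Rlt_le_trans; [exact Hz | apply Rmin_l]).
  assert (Hz2 : Cmod (z - w) < eps / (2 + Cmod l))
    by (eapply Rlt_le_trans; [exact Hz | apply Rmin_r]).
  specialize (Hd2 z Hz1).
  replace (f z - f w)%C with ((f z - f w - l * (z - w)) + l * (z - w))%C by ring.
  eapply Rle_lt_trans; [apply Cmod_triangle |]. rewrite Cmod_mult.
  pose proof (Cmod_ge_0 (z - w)) as H0.
  apply (Rmult_lt_compat_r (2 + Cmod l)) in Hz2; [| lra].
  unfold Rdiv in Hz2. rewrite Rmult_assoc, Rinv_l, Rmult_1_r in Hz2 by lra. nra.
Qed.

Lemma cderiv_ext (f g : C -> C) (w l : C) :
  (forall z, f z = g z) -> cderiv f w l -> cderiv g w l.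
Proof.
  intros E H eps Heps. destruct (H eps Heps) as [d [Hd1 Hd2]].
  exists d; split; [exact Hd1 |]. intros z Hz. rewrite <- !E. auto.
Qed.

Lemma cderiv_eq (f : C -> C) (w l m : C) : cderiv f w l -> l = m -> cderiv f w m.
Proof. intros H <-. exact H. Qed.

Lemma cderiv_const (c w : C) : cderiv (fun _ => c) w 0%C.
Proof. apply is_derive_iff_cderiv, (@is_derive_const C_AbsRing C_NormedModule). Qed.

Lemma cderiv_id (w : C) : cderiv (fun z => z) w 1%C.
Proof.
  intros eps Heps. exists 1; split; [lra |]. intros z _.
  replace (z - w - 1 * (z - w))%C with (RtoC 0) by ring.
  rewrite Cmod_0. pose proof (Cmod_ge_0 (z - w)). nra.
Qed.

Lemma cderiv_plus (f g : C -> C) (w l m : C) :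
  cderiv f w l -> cderiv g w m -> cderiv (fun z => f z + g z)%C w (l + m)%C.
Proof.
  intros Hf Hg. apply is_derive_iff_cderiv.
  apply (@is_derive_plus C_AbsRing C_NormedModule); apply is_derive_iff_cderiv; assumption.
Qed.

Lemma cderiv_minus (f g : C -> C) (w l m : C) :
  cderiv f w l -> cderiv g w m -> cderiv (fun z => f z - g z)%C w (l - m)%C.
Proof.
  intros Hf Hg. apply is_derive_iff_cderiv.
  apply (@is_derive_minus C_AbsRing C_NormedModule); apply is_derive_iff_cderiv; assumption.
Qed.

Lemma cderiv_mult (f g : C -> C) (w l m : C) :
  cderiv f w l -> cderiv g w m ->
  cderiv (fun z => f z * g z)%C w (l * g w + f w * m)%C.
Proof.
  intros Hf Hg eps Heps.
  pose proof (Cmod_ge_0 (f w)) as F0. pose proof (Cmod_ge_0 (g w)) as G0.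
  pose proof (Cmod_ge_0 l) as L0. pose proof (Cmod_ge_0 m) as M0.
  (* [K] dominates [|f w|], [|l|] and, once [|g z - g w| < 1], also [|g z|]. The error splits into
     three products, each at most [K * e * |z - w|] with [e = eps / (3 * K)]. *)
  set (K := 1 + Cmod (f w) + Cmod (g w) + Cmod l).
  assert (HK : 1 <= K) by (unfold K; lra).
  assert (He : 0 < eps / (3 * K)) by (apply Rdiv_lt_0_compat; lra).
  destruct (Hf _ He) as [d1 [Hd1 H1]]. destruct (Hg _ He) as [d2 [Hd2 H2]].
  destruct (cderiv_ccont g w m Hg _ He) as [d3 [Hd3 H3]].
  destruct (cderiv_ccont g w m Hg 1 Rlt_0_1) as [d4 [Hd4 H4]].
  exists (Rmin (Rmin d1 d2) (Rmin d3 d4)).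
  split; [repeat apply Rmin_pos; assumption |].
  intros z Hz.
  assert (Z1 : Cmod (z - w) < d1) by (eapply Rlt_le_trans; [exact Hz |];
    eapply Rle_trans; [apply Rmin_l | apply Rmin_l]).
  assert (Z2 : Cmod (z - w) < d2) by (eapply Rlt_le_trans; [exact Hz |];
    eapply Rle_trans; [apply Rmin_l | apply Rmin_r]).
  assert (Z3 : Cmod (z - w) < d3) by (eapply Rlt_le_trans; [exact Hz |];
    eapply Rle_trans; [apply Rmin_r | apply Rmin_l]).
  assert (Z4 : Cmod (z - w) < d4) by (eapply Rlt_le_trans; [exact Hz |];
    eapply Rle_trans; [apply Rmin_r | apply Rmin_r]).
  specialize (H1 z Z1). specialize (H2 z Z2). specialize (H3 z Z3). specialize (H4 z Z4).
  replace (f z * g z - f w * g w - (l * g w + f w * m) * (z - w))%C with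
    ((f z - f w - l * (z - w)) * g z + f w * (g z - g w - m * (z - w))
      + l * (z - w) * (g z - g w))%C by ring.
  assert (Hgz : Cmod (g z) <= K).
  { replace (g z) with ((g z - g w) + g w)%C by ring.
    eapply Rle_trans; [apply Cmod_triangle |]. unfold K. lra. }
  eapply Rle_trans; [apply Cmod_triangle |].
  eapply Rle_trans; [apply Rplus_le_compat_r, Cmod_triangle |].
  rewrite !Cmod_mult.
  set (D := Cmod (z - w)) in *. assert (D0 : 0 <= D) by apply Cmod_ge_0.
  set (e := eps / (3 * K)) in *.
  assert (Ee : eps = 3 * (K * e)) by (unfold e; field; lra).
  set (u := Cmod (f z - f w - l * (z - w))) in *.
  set (v := Cmod (g z - g w - m * (z - w))) in *.
  assert (0 <= u) by apply Cmod_ge_0. assert (0 <= v) by apply Cmod_ge_0.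
  assert (T1 : u * Cmod (g z) <= (e * D) * K).
  { apply Rmult_le_compat; auto using Cmod_ge_0. }
  assert (T2 : Cmod (f w) * v <= K * (e * D)).
  { apply Rmult_le_compat; auto. unfold K; lra. }
  assert (T3 : Cmod l * D * Cmod (g z - g w) <= K * D * e).
  { apply Rmult_le_compat; auto using Cmod_ge_0.
    - apply Rmult_le_pos; lra.
    - apply Rmult_le_compat_r; [lra | unfold K; lra].
    - lra. }
  rewrite Ee. nra.
Qed.

Lemma cderiv_scal (c : C) (f : C -> C) (w l : C) :
  cderiv f w l -> cderiv (fun z => c * f z)%C w (c * l)%C.
Proof.
  intros H. pose proof (cderiv_mult _ _ _ _ _ (cderiv_const c w) H) as K.
  replace (c * l)%C with (0 * f w + c * l)%C by ring. exact K.
Qed.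

Lemma cderiv_comp (f g : C -> C) (w l m : C) :
  cderiv f (g w) l -> cderiv g w m -> cderiv (fun z => f (g z)) w (l * m)%C.
Proof.
  intros Hf Hg eps Heps.
  pose proof (Cmod_ge_0 l) as L0. pose proof (Cmod_ge_0 m) as M0.
  set (K := 1 + Cmod l + Cmod m).
  assert (HK : 1 <= K) by (unfold K; lra).
  assert (He : 0 < eps / (2 * K)) by (apply Rdiv_lt_0_compat; lra).
  destruct (Hf _ He) as [d1 [Hd1 H1]]. destruct (Hg _ He) as [d2 [Hd2 H2]].
  destruct (Hg 1 Rlt_0_1) as [d3 [Hd3 H3]].
  destruct (cderiv_ccont g w m Hg d1 Hd1) as [d4 [Hd4 H4]].
  exists (Rmin (Rmin d2 d3) d4).
  split; [repeat apply Rmin_pos; assumption |].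
  intros z Hz.
  assert (Z2 : Cmod (z - w) < d2) by (eapply Rlt_le_trans; [exact Hz |];
    eapply Rle_trans; [apply Rmin_l | apply Rmin_l]).
  assert (Z3 : Cmod (z - w) < d3) by (eapply Rlt_le_trans; [exact Hz |];
    eapply Rle_trans; [apply Rmin_l | apply Rmin_r]).
  assert (Z4 : Cmod (z - w) < d4) by (eapply Rlt_le_trans; [exact Hz |]; apply Rmin_r).
  specialize (H1 _ (H4 z Z4)). specialize (H2 z Z2). specialize (H3 z Z3).
  replace (f (g z) - f (g w) - l * m * (z - w))%C with
    ((f (g z) - f (g w) - l * (g z - g w)) + l * (g z - g w - m * (z - w)))%C by ring.
  eapply Rle_trans; [apply Cmod_triangle |]. rewrite Cmod_mult.
  assert (Hgg : Cmod (g z - g w) <= K * Cmod (z - w)).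
  { replace (g z - g w)%C with ((g z - g w - m * (z - w)) + m * (z - w))%C by ring.
    eapply Rle_trans; [apply Cmod_triangle |]. rewrite Cmod_mult. unfold K.
    pose proof (Cmod_ge_0 (z - w)). nra. }
  set (D := Cmod (z - w)) in *. assert (D0 : 0 <= D) by apply Cmod_ge_0.
  set (e := eps / (2 * K)) in *.
  assert (Ee : eps = 2 * (K * e)) by (unfold e; field; lra).
  assert (T2 : Cmod l * Cmod (g z - g w - m * (z - w)) <= K * (e * D)).
  { apply Rmult_le_compat; auto using Cmod_ge_0. unfold K; lra. }
  assert (T1 : e * Cmod (g z - g w) <= e * (K * D)).
  { apply Rmult_le_compat_l; lra. }
  rewrite Ee. lra.
Qed.

Lemma cderiv_inv (w : C) : w <> 0%C -> cderiv Cinv w (- / (w * w))%C.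
Proof.
  intros Hw eps Heps.
  assert (W : 0 < Cmod w) by (apply Cmod_gt_0; exact Hw).
  set (a := Cmod w) in *.
  (* The error is [(z - w)^2 / (z * w^2)]. The first radius gives [|z| >= a / 2], hence a bound
     [2 * |z - w|^2 / a^3], which the second one turns into [eps * |z - w|]. *)
  exists (Rmin (a / 2) (eps * (a * a * a) / 2)). split.
  { apply Rmin_pos; [lra |]. apply Rdiv_lt_0_compat; [| lra].
    repeat apply Rmult_lt_0_compat; assumption. }
  intros z Hz.
  assert (Z1 : Cmod (z - w) < a / 2) by (eapply Rlt_le_trans; [exact Hz |]; apply Rmin_l).
  assert (Z2 : Cmod (z - w) < eps * (a * a * a) / 2)
    by (eapply Rlt_le_trans; [exact Hz |]; apply Rmin_r).
  assert (B : a / 2 <= Cmod z).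
  { assert (T := Cmod_triangle z (- (z - w))%C).
    replace (z + - (z - w))%C with w in T by ring. rewrite Cmod_opp in T.
    fold a in T. lra. }
  assert (Hz0 : z <> 0%C) by (apply Cmod_gt_0; lra).
  replace (/ z - / w - - / (w * w) * (z - w))%C with
    ((z - w) * (z - w) * / (z * (w * w)))%C by (field; auto).
  rewrite !Cmod_mult, Cmod_inv by (repeat apply Cmult_neq_0; assumption).
  rewrite !Cmod_mult. fold a.
  set (D := Cmod (z - w)) in *. assert (D0 : 0 <= D) by apply Cmod_ge_0.
  rewrite Rmult_assoc, Rmult_comm. apply Rmult_le_compat_r; [exact D0 |].
  apply Rmult_le_reg_r with (Cmod z * (a * a)); [apply Rmult_lt_0_compat; nra |].
  rewrite Rmult_assoc, Rinv_l by (apply Rgt_not_eq, Rmult_lt_0_compat; nra).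
  rewrite Rmult_1_r.
  eapply Rle_trans; [apply Rlt_le, Z2 |].
  replace (eps * (a * a * a) / 2) with (eps * ((a / 2) * (a * a))) by field.
  apply Rmult_le_compat_l; [lra |]. apply Rmult_le_compat_r; nra.
Qed.

Lemma Cmod_le_Rabs (z : C) : Cmod z <= Rabs (Re z) + Rabs (Im z).
Proof.
  destruct z as [x y]; simpl.
  replace (x, y) with (RtoC x + Ci * RtoC y)%C
    by (unfold RtoC, Ci, Cplus, Cmult; simpl; f_equal; ring).
  eapply Rle_trans; [apply Cmod_triangle |].
  rewrite Cmod_mult, Cmod_Ci, !Cmod_R. lra.
Qed.

Lemma im_le_Cmod (z : C) : Rabs (Im z) <= Cmod z.
Proof. eapply Rle_trans; [apply Rmax_r | apply Rmax_Cmod]. Qed.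

(** * Riemann integrals of complex-valued functions of a real variable *)

Definition is_CInt (f : R -> C) (a b : R) (l : C) : Prop :=
  @is_RInt C_R_NormedModule f a b l.

Definition CInt (f : R -> C) (a b : R) : C := @RInt C_R_CompleteNormedModule f a b.

Definition path_cont (f : R -> C) (t : R) : Prop := @continuous R_UniformSpace C_UniformSpace f t.

Lemma path_cont_iff (f : R -> C) (t : R) :
  path_cont f t <-> forall eps, 0 < eps -> exists d, 0 < d /\
    forall u, Rabs (u - t) < d -> Cmod (f u - f t) < eps.
Proof.
  split.
  - intros H eps Heps.
    (* Balls of the product uniform structure on [C] are squares; a square of radius [eps / 2] lies
       in the disc of radius [sqrt 2 * (eps / 2) <= eps]. *)
    assert (He : 0 < eps / 2) by lra.
    destruct (proj1 (filterlim_locally _ _) H (mkposreal _ He)) as [d Hd].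
    exists d; split; [apply cond_pos |]. intros u Hu.
    pose proof (C_NormedModule_mixin_compat2 (f t) (f u) (mkposreal _ He) (Hd u Hu)) as K.
    simpl in K. change (Cmod (f u - f t) < sqrt 2 * (eps / 2)) in K.
    eapply Rlt_le_trans; [exact K |].
    assert (sqrt 2 <= 2). { pose proof (sqrt_le_1 2 4). replace (sqrt 4) with 2 in H0.
      apply H0; lra. replace 4 with (2 * 2) by lra. rewrite sqrt_square; lra. }
    nra.
  - intros H. apply filterlim_locally. intros eps.
    destruct (H eps (cond_pos eps)) as [d [Hd1 Hd2]].
    exists (mkposreal d Hd1). intros u Hu.
    apply C_NormedModule_mixin_compat1. apply Hd2. exact Hu.
Qed.

Lemma ccont_path (f : C -> C) (g : R -> C) (t : R) :
  ccont f (g t) -> path_cont g t -> path_cont (fun u => f (g u)) t.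
Proof.
  intros Hf Hg. apply path_cont_iff. intros eps Heps.
  destruct (Hf eps Heps) as [d [Hd1 Hd2]].
  destruct (proj1 (path_cont_iff g t) Hg d Hd1) as [d' [Hd1' Hd2']].
  exists d'; split; auto.
Qed.

Lemma path_cont_h (y t : R) : path_cont (fun u => (u, y)) t.
Proof.
  apply path_cont_iff. intros eps Heps. exists eps; split; [exact Heps |].
  intros u Hu. replace ((u, y) - (t, y))%C with (RtoC (u - t)).
  - rewrite Cmod_R. exact Hu.
  - unfold RtoC, Cminus, Cplus, Copp; simpl; f_equal; ring.
Qed.

Lemma path_cont_v (x t : R) : path_cont (fun u => (x, u)) t.
Proof.
  apply path_cont_iff. intros eps Heps. exists eps; split; [exact Heps |].
  intros u Hu. replace ((x, u) - (x, t))%C with (Ci * RtoC (u - t))%C.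
  - rewrite Cmod_mult, Cmod_Ci, Cmod_R. lra.
  - unfold Ci, RtoC, Cminus, Cplus, Copp, Cmult; simpl; f_equal; ring.
Qed.

Lemma is_CInt_CInt_unordered (f : R -> C) (a b : R) :
  (forall t, Rmin a b <= t <= Rmax a b -> path_cont f t) -> is_CInt f a b (CInt f a b).
Proof.
  intros H. apply (@RInt_correct C_R_CompleteNormedModule).
  apply (@ex_RInt_continuous C_R_CompleteNormedModule). exact H.
Qed.

Lemma is_CInt_CInt (f : R -> C) (a b : R) :
  a <= b -> (forall t, a <= t <= b -> path_cont f t) -> is_CInt f a b (CInt f a b).
Proof.
  intros Hab H. apply is_CInt_CInt_unordered.
  rewrite Rmin_left, Rmax_right by exact Hab. exact H.
Qed.

Lemma is_CInt_unique (f : R -> C) (a b : R) (l m : C) :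
  is_CInt f a b l -> is_CInt f a b m -> l = m.
Proof.
  intros Hl Hm.
  transitivity (CInt f a b);
    [symmetry |]; apply (@is_RInt_unique C_R_CompleteNormedModule); assumption.
Qed.

Lemma is_CInt_ext (f g : R -> C) (a b : R) (l : C) :
  (forall t, f t = g t) -> is_CInt f a b l -> is_CInt g a b l.
Proof. intros E. apply is_RInt_ext. intros; apply E. Qed.

Lemma is_CInt_minus (f g : R -> C) (a b : R) (l m : C) :
  is_CInt f a b l -> is_CInt g a b m -> is_CInt (fun t => f t - g t)%C a b (l - m)%C.
Proof. apply (@is_RInt_minus C_R_NormedModule). Qed.

Lemma is_CInt_Chasles (f : R -> C) (a b c : R) (l m : C) :
  is_CInt f a b l -> is_CInt f b c m -> is_CInt f a c (l + m)%C.
Proof. apply (@is_RInt_Chasles C_R_NormedModule). Qed.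

Lemma is_CInt_components (f : R -> C) (a b : R) (l : C) :
  is_CInt f a b l <->
  is_RInt (fun t => Re (f t)) a b (Re l) /\ is_RInt (fun t => Im (f t)) a b (Im l).
Proof.
  split.
  - intros H; split.
    + apply (is_RInt_fct_extend_fst f a b l H).
    + apply (is_RInt_fct_extend_snd f a b l H).
  - intros [H1 H2]. destruct l as [u v].
    apply (is_RInt_fct_extend_pair (U := R_NormedModule) (V := R_NormedModule)); assumption.
Qed.

Lemma is_CInt_const (c : C) (a b : R) : is_CInt (fun _ => c) a b (RtoC (b - a) * c)%C.
Proof.
  rewrite <- scal_R_Cmult. apply (@is_RInt_const C_R_NormedModule).
Qed.

Lemma is_CInt_affine (u v : C) (a b : R) :
  is_CInt (fun t => u + v * RtoC t)%C a b
    (u * RtoC (b - a) + v * RtoC ((b ^ 2 - a ^ 2) / 2))%C.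
Proof.
  apply is_CInt_components. destruct u as [u1 u2], v as [v1 v2].
  assert (K : forall p q : R, is_RInt (fun t => p + q * t) a b
            (p * (b - a) + q * ((b ^ 2 - a ^ 2) / 2))).
  { intros p q.
    replace (p * (b - a) + q * ((b ^ 2 - a ^ 2) / 2)) with
      (minus (p * b + q * (b ^ 2 / 2)) (p * a + q * (a ^ 2 / 2)))
      by (unfold minus, plus, opp; simpl; field).
    apply (is_RInt_derive (V := R_CompleteNormedModule) (fun t => p * t + q * (t ^ 2 / 2))).
    - intros t _. auto_derive; [trivial | field].
    - intros t _. apply (ex_derive_continuous (K := R_AbsRing) (V := R_NormedModule)).
      auto_derive. trivial. }
  split; simpl.
  - apply (is_RInt_ext (V := R_NormedModule) (fun t => u1 + v1 * t)); [intros; simpl; ring |].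
    replace (_ + _) with (u1 * (b - a) + v1 * ((b ^ 2 - a ^ 2) / 2)) by (simpl; field).
    apply K.
  - apply (is_RInt_ext (V := R_NormedModule) (fun t => u2 + v2 * t)); [intros; simpl; ring |].
    replace (_ + _) with (u2 * (b - a) + v2 * ((b ^ 2 - a ^ 2) / 2)) by (simpl; field).
    apply K.
Qed.

Lemma is_CInt_bound (f : R -> C) (a b : R) (l : C) (M : R) :
  a <= b -> (forall t, a <= t <= b -> Cmod (f t) <= M) -> is_CInt f a b l ->
  Cmod l <= (b - a) * M.
Proof.
  intros Hab HM H. rewrite Cmod_norm.
  apply (@norm_RInt_le_const C_R_NormedModule f a b l M Hab); [| exact H].
  intros t Ht. specialize (HM t Ht). rewrite Cmod_norm in HM. exact HM.
Qed.

Lemma is_CInt_bound_abs (f : R -> C) (a b : R) (l : C) (M : R) :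
  (forall t, Rmin a b <= t <= Rmax a b -> Cmod (f t) <= M) -> is_CInt f a b l ->
  Cmod l <= Rabs (b - a) * M.
Proof.
  intros HM H. rewrite Cmod_norm.
  apply (@norm_RInt_le_const_abs C_R_NormedModule f a b l M); [| exact H].
  intros t Ht. specialize (HM t Ht). rewrite Cmod_norm in HM. exact HM.
Qed.

(** * Goursat's theorem on rectangles *)

Lemma half_pow_pos (n : nat) : 0 < (/ 2) ^ n.
Proof. apply pow_lt; lra. Qed.

Lemma half_pow_small (W d : R) : 0 < d -> exists n, W * (/ 2) ^ n < d.
Proof.
  intros Hd.
  destruct (pow_lt_1_zero (/ 2)) with (y := d / (1 + Rabs W)) as [N HN].
  - rewrite Rabs_right; lra.
  - apply Rdiv_lt_0_compat; [lra |]. pose proof (Rabs_pos W). lra.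
  - exists N. specialize (HN N (Nat.le_refl N)).
    pose proof (Rabs_pos W). pose proof (Rle_abs W). pose proof (half_pow_pos N).
    rewrite Rabs_right in HN by lra.
    apply (Rmult_lt_compat_r (1 + Rabs W)) in HN; [| lra].
    unfold Rdiv in HN. rewrite Rmult_assoc, Rinv_l, Rmult_1_r in HN by lra. nra.
Qed.

(** The hypothesis makes the left ends increase and the right ends [x n + W / 2^n] decrease, so the
    supremum of the left ends lies in every interval. *)
Lemma nested_intervals_point (x : nat -> R) (W : R) :
  0 <= W ->
  (forall n, x n <= x (S n) <= x n + W * (/ 2) ^ (S n)) ->
  exists p, forall n, x n <= p <= x n + W * (/ 2) ^ n.
Proof.
  intros HW Hx.
  assert (Up : forall n m, x n <= x (n + m)%nat).
  { intros n m. induction m as [| m IH]; [rewrite Nat.add_0_r; lra |].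
    rewrite Nat.add_succ_r. pose proof (Hx (n + m)%nat). lra. }
  assert (Dn : forall n m, x (n + m)%nat + W * (/ 2) ^ (n + m) <= x n + W * (/ 2) ^ n).
  { intros n m. induction m as [| m IH]; [rewrite Nat.add_0_r; lra |].
    rewrite Nat.add_succ_r. pose proof (Hx (n + m)%nat). simpl in *. lra. }
  assert (Le : forall n m, x m <= x n + W * (/ 2) ^ n).
  { intros n m. destruct (Nat.le_gt_cases n m) as [H | H].
    - replace m with (n + (m - n))%nat by lia. pose proof (Dn n (m - n)%nat).
      pose proof (half_pow_pos (n + (m - n))). nra.
    - pose proof (Up m (n - m)%nat) as K. replace (m + (n - m))%nat with n in K by lia.
      pose proof (half_pow_pos n). nra. }
  destruct (completeness (fun r => exists n, r = x n)) as [p [Hp1 Hp2]].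
  - exists (x 0%nat + W * (/ 2) ^ 0). intros r [n ->]. apply Le.
  - exists (x 0%nat), 0%nat. reflexivity.
  - exists p. intros n. split.
    + apply Hp1. exists n; reflexivity.
    + apply Hp2. intros r [m ->]. apply Le.
Qed.

(** Goursat's subdivision as an induction principle. If [P] failed, some quarter would fail as well,
    and so on; the failing rectangles shrink to a point, and the local hypothesis at that point is
    contradicted. *)
Lemma rect_bisection (P : R -> R -> R -> R -> Prop) (X0 X1 Y0 Y1 : R) :
  X0 <= X1 -> Y0 <= Y1 ->
  (forall x0 x1 y0 y1, X0 <= x0 -> x0 <= x1 -> x1 <= X1 -> Y0 <= y0 -> y0 <= y1 -> y1 <= Y1 ->
     P x0 ((x0 + x1) / 2) y0 ((y0 + y1) / 2) -> P ((x0 + x1) / 2) x1 y0 ((y0 + y1) / 2) ->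
     P x0 ((x0 + x1) / 2) ((y0 + y1) / 2) y1 -> P ((x0 + x1) / 2) x1 ((y0 + y1) / 2) y1 ->
     P x0 x1 y0 y1) ->
  (forall px py, X0 <= px <= X1 -> Y0 <= py <= Y1 -> exists d, 0 < d /\
     forall x0 x1 y0 y1, X0 <= x0 <= px -> px <= x1 <= X1 -> Y0 <= y0 <= py -> py <= y1 <= Y1 ->
       x1 - x0 < d -> y1 - y0 < d -> P x0 x1 y0 y1) ->
  P X0 X1 Y0 Y1.
Proof.
  intros HX HY Hsplit Hloc. apply NNPP. intros Hbad.
  set (W := X1 - X0). set (H := Y1 - Y0).
  (* Only the lower left corner [r] of the failing rectangle is recorded, since the side lengths at
     stage [n] are [W / 2^n] and [H / 2^n]. *)
  set (Q := fun (n : nat) (r : R * R) =>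
    X0 <= fst r /\ fst r + W * (/ 2) ^ n <= X1 /\
    Y0 <= snd r /\ snd r + H * (/ 2) ^ n <= Y1 /\
    ~ P (fst r) (fst r + W * (/ 2) ^ n) (snd r) (snd r + H * (/ 2) ^ n)).
  assert (W0 : 0 <= W) by (unfold W; lra). assert (H0 : 0 <= H) by (unfold H; lra).
  assert (step : forall n r, Q n r -> exists r', Q (S n) r' /\
    fst r <= fst r' <= fst r + W * (/ 2) ^ (S n) /\
    snd r <= snd r' <= snd r + H * (/ 2) ^ (S n)).
  { intros n [x y] [A1 [A2 [A3 [A4 A5]]]]. simpl fst in *; simpl snd in *.
    assert (Ew : W * (/ 2) ^ n = 2 * (W * (/ 2) ^ S n)) by (simpl; field).
    assert (Eh : H * (/ 2) ^ n = 2 * (H * (/ 2) ^ S n)) by (simpl; field).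
    assert (Bw : 0 <= W * (/ 2) ^ S n)
      by (apply Rmult_le_pos; [lra | apply Rlt_le, half_pow_pos]).
    assert (Bh : 0 <= H * (/ 2) ^ S n)
      by (apply Rmult_le_pos; [lra | apply Rlt_le, half_pow_pos]).
    rewrite Ew in *. rewrite Eh in *.
    unfold Q.
    set (w := W * (/ 2) ^ S n) in *. set (h := H * (/ 2) ^ S n) in *.
    apply NNPP. intros Hno. apply A5. apply Hsplit; try lra.
    - replace ((x + (x + 2 * w)) / 2) with (x + w) by field.
      replace ((y + (y + 2 * h)) / 2) with (y + h) by field.
      apply NNPP. intros N. apply Hno. exists (x, y). simpl. repeat split; auto; lra.
    - replace ((x + (x + 2 * w)) / 2) with (x + w) by field.
      replace ((y + (y + 2 * h)) / 2) with (y + h) by field.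
      replace (x + 2 * w) with (x + w + w) by ring.
      apply NNPP. intros N. apply Hno. exists (x + w, y). simpl. repeat split; auto; lra.
    - replace ((x + (x + 2 * w)) / 2) with (x + w) by field.
      replace ((y + (y + 2 * h)) / 2) with (y + h) by field.
      replace (y + 2 * h) with (y + h + h) by ring.
      apply NNPP. intros N. apply Hno. exists (x, y + h). simpl. repeat split; auto; lra.
    - replace ((x + (x + 2 * w)) / 2) with (x + w) by field.
      replace ((y + (y + 2 * h)) / 2) with (y + h) by field.
      replace (x + 2 * w) with (x + w + w) by ring.
      replace (y + 2 * h) with (y + h + h) by ring.
      apply NNPP. intros N. apply Hno. exists (x + w, y + h). simpl. repeat split; auto; lra. }
  assert (Q0 : Q 0%nat (X0, Y0)).
  { unfold Q; simpl. replace (X0 + W * 1) with X1 by (unfold W; ring).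
    replace (Y0 + H * 1) with Y1 by (unfold H; ring). repeat split; auto; lra. }
  (* Dependent choice: each corner carries its proof of [Q n], from which the next corner is
     chosen. *)
  set (next := fun n (r : {r | Q n r}) =>
    constructive_indefinite_description _ (step n (proj1_sig r) (proj2_sig r))).
  set (sq := nat_rect (fun n => {r | Q n r}) (exist _ (X0, Y0) Q0)
    (fun n r => exist _ (proj1_sig (next n r)) (proj1 (proj2_sig (next n r))))).
  set (s := fun n => proj1_sig (sq n)).
  assert (Hs : forall n, Q n (s n)) by (intros n; exact (proj2_sig (sq n))).
  assert (Hn : forall n, fst (s n) <= fst (s (S n)) <= fst (s n) + W * (/ 2) ^ (S n) /\
                         snd (s n) <= snd (s (S n)) <= snd (s n) + H * (/ 2) ^ (S n)).
  { intros n. exact (proj2 (proj2_sig (next n (sq n)))). }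
  destruct (nested_intervals_point (fun n => fst (s n)) W W0) as [px Hpx];
    [intros n; apply Hn |].
  destruct (nested_intervals_point (fun n => snd (s n)) H H0) as [py Hpy];
    [intros n; apply Hn |].
  destruct (Hloc px py) as [d [Hd1 Hd2]].
  { pose proof (Hpx 0%nat) as K. pose proof (Hs 0%nat) as [K1 [K2 _]]. lra. }
  { pose proof (Hpy 0%nat) as K. pose proof (Hs 0%nat) as [_ [_ [K1 [K2 _]]]]. lra. }
  destruct (half_pow_small (W + H) d Hd1) as [n Hsmall].
  pose proof (half_pow_pos n) as Hp.
  assert (Sw : 0 <= W * (/ 2) ^ n) by nra. assert (Sh : 0 <= H * (/ 2) ^ n) by nra.
  rewrite Rmult_plus_distr_r in Hsmall.
  destruct (Hs n) as [K1 [K2 [K3 [K4 K5]]]]. specialize (Hpx n). specialize (Hpy n).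
  simpl in Hpx, Hpy.
  apply K5. apply Hd2; lra.
Qed.

(** The counterclockwise contour integral of [f dz]: bottom, right, top and left side, with
    [dz = i dy] on the vertical ones. *)
Definition rect_int (f : C -> C) (x0 x1 y0 y1 : R) : C :=
  (CInt (fun x => f (x, y0)) x0 x1 + Ci * CInt (fun y => f (x1, y)) y0 y1
   - CInt (fun x => f (x, y1)) x0 x1 - Ci * CInt (fun y => f (x0, y)) y0 y1)%C.

Definition in_rect (x0 x1 y0 y1 : R) (z : C) : Prop :=
  x0 <= Re z <= x1 /\ y0 <= Im z <= y1.

Lemma hseg_CInt (f : C -> C) (x0 x1 y : R) :
  x0 <= x1 -> (forall x, x0 <= x <= x1 -> ccont f (x, y)) ->
  is_CInt (fun x => f (x, y)) x0 x1 (CInt (fun x => f (x, y)) x0 x1).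
Proof.
  intros H Hc. apply is_CInt_CInt; [exact H |]. intros t Ht.
  apply (ccont_path f (fun u => (u, y))); [auto | apply path_cont_h].
Qed.

Lemma vseg_CInt (f : C -> C) (y0 y1 x : R) :
  y0 <= y1 -> (forall y, y0 <= y <= y1 -> ccont f (x, y)) ->
  is_CInt (fun y => f (x, y)) y0 y1 (CInt (fun y => f (x, y)) y0 y1).
Proof.
  intros H Hc. apply is_CInt_CInt; [exact H |]. intros t Ht.
  apply (ccont_path f (fun u => (x, u))); [auto | apply path_cont_v].
Qed.

Lemma hseg_Chasles (f : C -> C) (x0 x1 x2 y : R) :
  x0 <= x1 -> x1 <= x2 -> (forall x, x0 <= x <= x2 -> ccont f (x, y)) ->
  CInt (fun x => f (x, y)) x0 x2
  = (CInt (fun x => f (x, y)) x0 x1 + CInt (fun x => f (x, y)) x1 x2)%C.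
Proof.
  intros H1 H2 Hc. eapply is_CInt_unique.
  - apply hseg_CInt; [lra | exact Hc].
  - eapply is_CInt_Chasles; apply hseg_CInt; try lra; intros; apply Hc; lra.
Qed.

Lemma vseg_Chasles (f : C -> C) (y0 y1 y2 x : R) :
  y0 <= y1 -> y1 <= y2 -> (forall y, y0 <= y <= y2 -> ccont f (x, y)) ->
  CInt (fun y => f (x, y)) y0 y2
  = (CInt (fun y => f (x, y)) y0 y1 + CInt (fun y => f (x, y)) y1 y2)%C.
Proof.
  intros H1 H2 Hc. eapply is_CInt_unique.
  - apply vseg_CInt; [lra | exact Hc].
  - eapply is_CInt_Chasles; apply vseg_CInt; try lra; intros; apply Hc; lra.
Qed.

Lemma C_pair_affine (x y : R) : (x, y) = (RtoC x + Ci * RtoC y)%C.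
Proof. unfold RtoC, Ci, Cplus, Cmult; simpl; f_equal; ring. Qed.

Lemma rect_int_affine (u v : C) (x0 x1 y0 y1 : R) :
  rect_int (fun z => u + v * z)%C x0 x1 y0 y1 = 0%C.
Proof.
  assert (Hh : forall y, CInt (fun x => u + v * (x, y))%C x0 x1
     = ((u + v * Ci * RtoC y) * RtoC (x1 - x0) + v * RtoC ((x1 ^ 2 - x0 ^ 2) / 2))%C).
  { intros y. apply (@is_RInt_unique C_R_CompleteNormedModule).
    apply (is_CInt_ext (fun t => (u + v * Ci * RtoC y) + v * RtoC t)%C).
    - intros t. rewrite (C_pair_affine t y). ring.
    - apply is_CInt_affine. }
  assert (Hv : forall x, CInt (fun y => u + v * (x, y))%C y0 y1
     = ((u + v * RtoC x) * RtoC (y1 - y0) + v * Ci * RtoC ((y1 ^ 2 - y0 ^ 2) / 2))%C).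
  { intros x. apply (@is_RInt_unique C_R_CompleteNormedModule).
    apply (is_CInt_ext (fun t => (u + v * RtoC x) + v * Ci * RtoC t)%C).
    - intros t. rewrite (C_pair_affine x t). ring.
    - apply is_CInt_affine. }
  unfold rect_int. rewrite !Hh, !Hv. destruct u as [u1 u2], v as [v1 v2].
  unfold RtoC, Ci, Cminus, Cplus, Copp, Cmult; simpl. f_equal; field.
Qed.

Lemma Cmod_4 (a b c d : C) :
  Cmod (a + Ci * b - c - Ci * d) <= Cmod a + Cmod b + Cmod c + Cmod d.
Proof.
  unfold Cminus.
  eapply Rle_trans; [apply Cmod_triangle |].
  eapply Rle_trans; [apply Rplus_le_compat_r, Cmod_triangle |].
  eapply Rle_trans; [apply Rplus_le_compat_r, Rplus_le_compat_r, Cmod_triangle |].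
  rewrite !Cmod_opp, !Cmod_mult, Cmod_Ci. lra.
Qed.

(** The affine function has zero contour integral, so it can be subtracted from [f]; what remains is
    at most the perimeter times [M]. In Goursat's theorem it is the tangent approximation. *)
Lemma rect_int_small (f : C -> C) (u v : C) (x0 x1 y0 y1 M : R) :
  x0 <= x1 -> y0 <= y1 -> (forall z, in_rect x0 x1 y0 y1 z -> ccont f z) ->
  (forall z, in_rect x0 x1 y0 y1 z -> Cmod (f z - (u + v * z)) <= M) ->
  Cmod (rect_int f x0 x1 y0 y1) <= 2 * (x1 - x0 + (y1 - y0)) * M.
Proof.
  intros Hx Hy Hc HM.
  replace (rect_int f x0 x1 y0 y1)
    with (rect_int f x0 x1 y0 y1 - rect_int (fun z => u + v * z)%C x0 x1 y0 y1)%C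
    by (rewrite rect_int_affine; ring).
  assert (Ha : forall z, ccont (fun z => u + v * z)%C z).
  { intros z. eapply cderiv_ccont. eapply cderiv_plus; [apply cderiv_const |].
    apply cderiv_scal, cderiv_id. }
  assert (Bh : forall y, y0 <= y <= y1 ->
    Cmod (CInt (fun x => f (x, y)) x0 x1 - CInt (fun x => u + v * (x, y))%C x0 x1)
      <= (x1 - x0) * M).
  { intros y H. eapply is_CInt_bound; [exact Hx | |].
    2:{ apply is_CInt_minus; [apply hseg_CInt; [exact Hx |] | apply (hseg_CInt (fun z => u + v * z)%C); auto].
        intros x Hxx. apply Hc. split; simpl; auto. }
    intros t Ht. apply HM. split; simpl; auto. }
  assert (Bv : forall x, x0 <= x <= x1 ->
    Cmod (CInt (fun y => f (x, y)) y0 y1 - CInt (fun y => u + v * (x, y))%C y0 y1)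
      <= (y1 - y0) * M).
  { intros x H. eapply is_CInt_bound; [exact Hy | |].
    2:{ apply is_CInt_minus; [apply vseg_CInt; [exact Hy |] | apply (vseg_CInt (fun z => u + v * z)%C); auto].
        intros y Hyy. apply Hc. split; simpl; auto. }
    intros t Ht. apply HM. split; simpl; auto. }
  unfold rect_int.
  match goal with |- Cmod ?e <= _ => replace e with
    ((CInt (fun x => f (x, y0)) x0 x1 - CInt (fun x => u + v * (x, y0))%C x0 x1)
     + Ci * (CInt (fun y => f (x1, y)) y0 y1 - CInt (fun y => u + v * (x1, y))%C y0 y1)
     - (CInt (fun x => f (x, y1)) x0 x1 - CInt (fun x => u + v * (x, y1))%C x0 x1)
     - Ci * (CInt (fun y => f (x0, y)) y0 y1 - CInt (fun y => u + v * (x0, y))%C y0 y1))%C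
    by ring end.
  eapply Rle_trans; [apply Cmod_4 |].
  assert (A1 := Bh y0 ltac:(lra)). assert (A2 := Bh y1 ltac:(lra)).
  assert (A3 := Bv x0 ltac:(lra)). assert (A4 := Bv x1 ltac:(lra)). lra.
Qed.

Lemma goursat (f : C -> C) (x0 x1 y0 y1 : R) :
  x0 <= x1 -> y0 <= y1 ->
  (forall z, in_rect x0 x1 y0 y1 z -> exists l, cderiv f z l) ->
  rect_int f x0 x1 y0 y1 = 0%C.
Proof.
  intros HX HY Hd.
  assert (Hc : forall z, in_rect x0 x1 y0 y1 z -> ccont f z).
  { intros z Hz. destruct (Hd z Hz) as [l Hl]. eapply cderiv_ccont, Hl. }
  (* The square of the half perimeter suits quartering: each quarter has a fourth of the bound, so
     the four bounds add up exactly to that of the whole. *)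
  assert (Main : forall eps, 0 < eps ->
    Cmod (rect_int f x0 x1 y0 y1) <= eps * (x1 - x0 + (y1 - y0)) ^ 2).
  { intros eps Heps.
    apply (rect_bisection (fun a b c d =>
      Cmod (rect_int f a b c d) <= eps * (b - a + (d - c)) ^ 2)); auto.
    - intros a b c d A1 A2 A3 A4 A5 A6 P1 P2 P3 P4.
      assert (E : rect_int f a b c d =
        (rect_int f a ((a + b) / 2) c ((c + d) / 2) + rect_int f ((a + b) / 2) b c ((c + d) / 2)
         + rect_int f a ((a + b) / 2) ((c + d) / 2) d + rect_int f ((a + b) / 2) b ((c + d) / 2) d)%C).
      { unfold rect_int.
        assert (Sh : forall y, c <= y <= d -> CInt (fun x => f (x, y)) a b =
           (CInt (fun x => f (x, y)) a ((a + b) / 2) + CInt (fun x => f (x, y)) ((a + b) / 2) b)%C).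
        { intros y Hy. apply hseg_Chasles; try lra. intros x Hx. apply Hc. split; simpl; lra. }
        assert (Sv : forall x, a <= x <= b -> CInt (fun y => f (x, y)) c d =
           (CInt (fun y => f (x, y)) c ((c + d) / 2) + CInt (fun y => f (x, y)) ((c + d) / 2) d)%C).
        { intros x Hx. apply vseg_Chasles; try lra. intros y Hy. apply Hc. split; simpl; lra. }
        rewrite (Sh c), (Sh d), (Sv a), (Sv b) by lra. ring. }
      rewrite E.
      eapply Rle_trans; [apply Cmod_triangle |].
      eapply Rle_trans; [apply Rplus_le_compat_r, Cmod_triangle |].
      eapply Rle_trans; [apply Rplus_le_compat_r, Rplus_le_compat_r, Cmod_triangle |].
      eapply Rle_trans; [apply Rplus_le_compat; [apply Rplus_le_compat; [apply Rplus_le_compat |] |]; eassumption |].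
      right. field.
    - intros px py Hpx Hpy.
      destruct (Hd (px, py)) as [l Hl]; [split; simpl; lra |].
      (* With half perimeter [p], points of the rectangle are within [p] of [(px, py)], so the
         tangent error is at most [eps / 2 * p]. Times the perimeter [2 * p] this is [eps * p^2].
         Both sides below [d / 2] give [p < d]. *)
      assert (He : 0 < eps / 2) by lra.
      destruct (Hl _ He) as [d [Hd1 Hd2]].
      exists (d / 2). split; [lra |].
      intros a b c e B1 B2 B3 B4 B5 B6.
      eapply Rle_trans.
      + apply (rect_int_small f (f (px, py) - l * (px, py))%C l a b c e
          (eps / 2 * (b - a + (e - c)))); try lra.
        * intros z [Z1 Z2]. apply Hc. split; lra.
        * intros z [Z1 Z2].
          assert (Hz : Cmod (z - (px, py)) <= b - a + (e - c)).
          { eapply Rle_trans; [apply Cmod_le_Rabs |]. destruct z as [zx zy]; simpl in *.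
            apply Rplus_le_compat; apply Rabs_le; lra. }
          replace (f z - (f (px, py) - l * (px, py) + l * z))%C
            with (f z - f (px, py) - l * (z - (px, py)))%C by ring.
          eapply Rle_trans; [apply Hd2; lra |]. apply Rmult_le_compat_l; lra.
      + right. field. }
  destruct (Ceq_dec (rect_int f x0 x1 y0 y1) 0%C) as [E | NE]; [exact E | exfalso].
  apply Cmod_gt_0 in NE.
  set (K := (x1 - x0 + (y1 - y0)) ^ 2) in *.
  assert (K0 : 0 <= K) by (unfold K; apply pow2_ge_0).
  set (m := Cmod (rect_int f x0 x1 y0 y1)) in *.
  assert (T := Main (m / (2 * (K + 1))) ltac:(apply Rdiv_lt_0_compat; lra)).
  assert (m / (2 * (K + 1)) * K <= m / 2).
  { replace (m / 2) with (m / (2 * (K + 1)) * (K + 1)) by (field; lra).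
    apply Rmult_le_compat_l; [| lra]. apply Rlt_le, Rdiv_lt_0_compat; lra. }
  lra.
Qed.

(** * Cauchy's estimate for the derivative *)

Definition cexp (z : C) : C := (exp (Re z) * cos (Im z), exp (Re z) * sin (Im z)).

Lemma cexp_plus (z w : C) : cexp (z + w) = (cexp z * cexp w)%C.
Proof.
  destruct z as [x y], w as [u v]. unfold cexp, Cplus, Cmult; simpl.
  rewrite exp_plus, cos_plus, sin_plus. f_equal; ring.
Qed.

Lemma Cmod_cexp (z : C) : Cmod (cexp z) = exp (Re z).
Proof.
  unfold Cmod, cexp; simpl fst; simpl snd.
  replace ((exp (Re z) * cos (Im z)) ^ 2 + (exp (Re z) * sin (Im z)) ^ 2)
    with (exp (Re z) * exp (Re z) * (Rsqr (sin (Im z)) + Rsqr (cos (Im z))))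
    by (unfold Rsqr; ring).
  rewrite sin2_cos2, Rmult_1_r. apply sqrt_square. apply Rlt_le, exp_pos.
Qed.

Lemma cexp_0 : cexp 0 = 1%C.
Proof. unfold cexp; simpl. rewrite exp_0, cos_0, sin_0. unfold RtoC. f_equal; ring. Qed.

Lemma derivable_lim_0 (f : R -> R) (l : R) :
  derivable_pt_lim f 0 l -> forall eps, 0 < eps -> exists d, 0 < d /\
    forall t, Rabs t < d -> Rabs (f t - f 0 - l * t) <= eps * Rabs t.
Proof.
  intros H eps Heps. destruct (H eps Heps) as [d Hd].
  exists d; split; [apply cond_pos |]. intros t Ht.
  destruct (Req_dec t 0) as [-> | Nt].
  - rewrite !Rmult_0_r, Rabs_R0, Rminus_0_r, Rminus_diag, Rabs_R0. lra.
  - specialize (Hd t Nt Ht). rewrite Rplus_0_l in Hd.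
    replace (f t - f 0 - l * t) with (((f t - f 0) / t - l) * t) by (field; exact Nt).
    rewrite Rabs_mult. apply Rmult_le_compat_r; [apply Rabs_pos | lra].
Qed.

Lemma cderiv_cexp_0 : cderiv cexp 0%C 1%C.
Proof.
  intros eps Heps.
  (* The real part of the error is at most [2 e |t| + e |s|], the imaginary part at most
     [2 e |t| + e |t|]: six times [e * |z|] in all. The radius [e / 2] below ensures
     [|exp s - 1| <= e]. *)
  set (e := Rmin 1 (eps / 6)).
  assert (He : 0 < e) by (apply Rmin_pos; lra).
  assert (He1 : e <= 1) by apply Rmin_l.
  assert (He2 : 6 * e <= eps) by (pose proof (Rmin_r 1 (eps / 6)); unfold e; lra).
  assert (De := derivable_pt_lim_exp 0). rewrite exp_0 in De.
  assert (Ds := derivable_pt_lim_sin 0). rewrite cos_0 in Ds.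
  assert (Dc := derivable_pt_lim_cos 0). rewrite sin_0, Ropp_0 in Dc.
  destruct (derivable_lim_0 _ _ De e He) as [d1 [P1 H1]].
  destruct (derivable_lim_0 _ _ Ds e He) as [d2 [P2 H2]].
  destruct (derivable_lim_0 _ _ Dc e He) as [d3 [P3 H3]].
  exists (Rmin (Rmin d1 d2) (Rmin d3 (e / 2))).
  split; [repeat apply Rmin_pos; lra |].
  intros z Hz. rewrite cexp_0. replace (z - 0)%C with z in * by ring.
  destruct z as [s t].
  assert (Ls : Rabs s <= Cmod (s, t)) by apply (re_le_Cmod (s, t)).
  assert (Lt : Rabs t <= Cmod (s, t)) by apply (im_le_Cmod (s, t)).
  pose proof (Rmin_l (Rmin d1 d2) (Rmin d3 (e / 2))). pose proof (Rmin_r (Rmin d1 d2) (Rmin d3 (e / 2))).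
  pose proof (Rmin_l d1 d2). pose proof (Rmin_r d1 d2).
  pose proof (Rmin_l d3 (e / 2)). pose proof (Rmin_r d3 (e / 2)).
  specialize (H1 s ltac:(lra)). specialize (H2 t ltac:(lra)). specialize (H3 t ltac:(lra)).
  rewrite exp_0 in H1. rewrite sin_0 in H2. rewrite cos_0 in H3.
  rewrite Rminus_0_r in H2. rewrite Rmult_0_l, Rminus_0_r in H3.
  rewrite Rmult_1_l in H1, H2.
  set (m := Cmod (s, t)) in *.
  pose proof (Rabs_pos s) as S0. pose proof (Rabs_pos t) as T0.
  assert (E1 : Rabs (exp s - 1) <= e).
  { replace (exp s - 1) with ((exp s - 1 - s) + s) by ring.
    eapply Rle_trans; [apply Rabs_triang |]. nra. }
  assert (E2 : Rabs (exp s) <= 2).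
  { replace (exp s) with ((exp s - 1) + 1) by ring.
    eapply Rle_trans; [apply Rabs_triang |]. rewrite Rabs_R1. lra. }
  eapply Rle_trans; [apply Cmod_le_Rabs |].
  replace (Re (cexp (s, t) - 1 - 1 * (s, t))) with (exp s * (cos t - 1) + (exp s - 1 - s))
    by (simpl; ring).
  replace (Im (cexp (s, t) - 1 - 1 * (s, t))) with (exp s * (sin t - t) + (exp s - 1) * t)
    by (simpl; ring).
  assert (A1 : Rabs (exp s * (cos t - 1)) <= 2 * (e * Rabs t)).
  { rewrite Rabs_mult. apply Rmult_le_compat; auto using Rabs_pos. }
  assert (A2 : Rabs (exp s * (sin t - t)) <= 2 * (e * Rabs t)).
  { rewrite Rabs_mult. apply Rmult_le_compat; auto using Rabs_pos. }
  assert (A3 : Rabs ((exp s - 1) * t) <= e * Rabs t).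
  { rewrite Rabs_mult. apply Rmult_le_compat_r; auto. }
  pose proof (Rabs_triang (exp s * (cos t - 1)) (exp s - 1 - s)).
  pose proof (Rabs_triang (exp s * (sin t - t)) ((exp s - 1) * t)).
  assert (e * Rabs t <= e * m) by (apply Rmult_le_compat_l; lra).
  assert (e * Rabs s <= e * m) by (apply Rmult_le_compat_l; lra).
  assert (0 <= m) by lra. nra.
Qed.

(** The functional equation transports the derivative from 0 to every point. *)
Lemma cderiv_cexp (w : C) : cderiv cexp w (cexp w).
Proof.
  apply (cderiv_ext (fun z => cexp w * cexp (z - w))%C).
  { intros z. rewrite <- cexp_plus. f_equal. ring. }
  apply cderiv_eq with (cexp w * (1 * (1 - 0)))%C; [| ring].
  apply cderiv_scal. apply (cderiv_comp cexp (fun z => z - w)%C).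
  - replace (w - w)%C with (RtoC 0) by ring. apply cderiv_cexp_0.
  - apply cderiv_minus; [apply cderiv_id | apply cderiv_const].
Qed.

(* In the coordinate [zeta], [z = w + exp zeta], the difference quotient
   [(f z - f w) / (z - w)] is holomorphic and [2 i PI]-periodic on a half-plane: by
   Goursat on a rectangle of height [2 PI] its integral over a period does not depend
   on [Re zeta], and it tends to [2 PI f'(w)] as [Re zeta -> -oo]. *)
Lemma cauchy_estimate (f : C -> C) (w l : C) (r B : R) :
  0 < r ->
  (forall z, Cmod (z - w) <= r -> exists m, cderiv f z m) ->
  (forall z, Cmod (z - w) <= r -> Cmod (f z) <= B) ->
  cderiv f w l -> Cmod l <= 2 * B / r.
Proof.
  intros Hr Hd HB Hl.
  set (G := fun zeta : C => ((f (w + cexp zeta) - f w) * cexp (- zeta))%C).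
  set (s1 := ln r).
  assert (Es1 : exp s1 = r) by (apply exp_ln; exact Hr).
  assert (Hin : forall zeta, Re zeta <= s1 -> Cmod (w + cexp zeta - w) <= r).
  { intros zeta Hz. replace (w + cexp zeta - w)%C with (cexp zeta) by ring.
    rewrite Cmod_cexp, <- Es1. destruct Hz as [Hz | ->]; [left; apply exp_increasing; exact Hz | lra]. }
  assert (GD : forall zeta, Re zeta <= s1 -> exists m, cderiv G zeta m).
  { intros zeta Hz. destruct (Hd _ (Hin zeta Hz)) as [m Hm].
    eexists. apply cderiv_mult.
    - apply cderiv_minus; [| apply cderiv_const].
      apply (cderiv_comp f (fun u => w + cexp u)%C); [exact Hm |].
      apply cderiv_plus; [apply cderiv_const | apply cderiv_cexp].
    - apply (cderiv_comp cexp (fun u => - u)%C); [apply cderiv_cexp |].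
      apply (cderiv_ext (fun u => 0 - u)%C); [intros; ring |].
      apply cderiv_minus; [apply cderiv_const | apply cderiv_id]. }
  assert (GC : forall zeta, Re zeta <= s1 -> ccont G zeta).
  { intros zeta Hz. destruct (GD zeta Hz) as [m Hm]. eapply cderiv_ccont, Hm. }
  set (V := fun s : R => CInt (fun t => G (s, t)) 0 (2 * PI)).
  pose proof PI_RGT_0 as HPI.
  assert (Vint : forall s, s <= s1 -> is_CInt (fun t => G (s, t)) 0 (2 * PI) (V s)).
  { intros s Hs. apply vseg_CInt; [lra |]. intros t _. apply GC. exact Hs. }
  assert (Vc : forall s, s <= s1 -> V s = V s1).
  { intros s Hs.
    assert (E : rect_int G s s1 0 (2 * PI) = 0%C).
    { apply goursat; [exact Hs | lra |]. intros z [Hz _]. apply GD. lra. }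
    unfold rect_int in E. fold (V s) in E. fold (V s1) in E.
    (* By periodicity the two horizontal sides cancel, leaving [i * (V s1 - V s) = 0]. *)
    assert (P : CInt (fun x => G (x, 2 * PI)) s s1 = CInt (fun x => G (x, 0)) s s1).
    { apply (@RInt_ext C_R_CompleteNormedModule). intros x _.
      unfold G, cexp; simpl. rewrite cos_neg, sin_neg, cos_2PI, sin_2PI.
      rewrite cos_neg, sin_neg, cos_0, sin_0. reflexivity. }
    rewrite P in E.
    assert (E' : (Ci * (V s1 - V s))%C = 0%C) by (rewrite <- E; ring).
    replace (V s1) with (V s - Ci * (Ci * (V s1 - V s)))%C.
    - rewrite E'. ring.
    - replace (Ci * (Ci * (V s1 - V s)))%C with (Ci * Ci * (V s1 - V s))%C by ring.
      replace (Ci * Ci)%C with (RtoC (-1)) by (unfold Ci, Cmult, RtoC; simpl; f_equal; ring).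
      replace (RtoC (-1)) with (- (1))%C by (unfold RtoC, Copp; simpl; f_equal; ring). ring. }
  (* On the circle of radius [r] the numerator is a difference of two values of [f], hence the
     factor 2. *)
  assert (B1 : Cmod (V s1) <= (2 * PI - 0) * (2 * B / r)).
  { eapply is_CInt_bound; [lra | | apply Vint; lra].
    intros t _. unfold G. rewrite Cmod_mult, Cmod_cexp. simpl Re.
    replace (Re (- (s1, t))) with (- s1) by reflexivity.
    rewrite exp_Ropp, Es1. unfold Rdiv. apply Rmult_le_compat_r; [apply Rlt_le, Rinv_0_lt_compat, Hr |].
    eapply Rle_trans; [apply Cmod_triangle |]. rewrite Cmod_opp.
    assert (K1 := HB _ (Hin (s1, t) (Rle_refl _))).
    assert (K2 := HB w). replace (w - w)%C with (RtoC 0) in K2 by ring.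
    rewrite Cmod_0 in K2. specialize (K2 (Rlt_le _ _ Hr)). lra. }
  assert (Main : forall eps, 0 < eps -> Cmod l <= 2 * B / r + eps).
  { intros eps Heps. destruct (Hl eps Heps) as [d [Hd1 Hd2]].
    (* The line [Re zeta = s] corresponds to the circle of radius [exp s < d] around [w], on which
       the difference quotient is within [eps] of [l]. *)
    set (s := Rmin s1 (ln (d / 2))).
    assert (Hs : s <= s1) by apply Rmin_l.
    assert (Hsd : exp s < d).
    { apply Rle_lt_trans with (d / 2); [| lra].
      rewrite <- (exp_ln (d / 2)) by lra.
      destruct (Rmin_r s1 (ln (d / 2))) as [K | K]; fold s in K;
        [left; apply exp_increasing; exact K | rewrite K; lra]. }
    assert (B2 : Cmod (V s - RtoC (2 * PI - 0) * l) <= (2 * PI - 0) * eps).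
    { eapply is_CInt_bound; [| | apply is_CInt_minus; [apply Vint, Hs | apply is_CInt_const]]; [lra |].
      intros t _. simpl. unfold G.
      assert (En : (cexp (s, t) * cexp (- (s, t)))%C = 1%C).
      { rewrite <- cexp_plus. replace ((s, t) + - (s, t))%C with (RtoC 0) by ring. apply cexp_0. }
      replace ((f (w + cexp (s, t)) - f w) * cexp (- (s, t)) - l)%C
        with ((f (w + cexp (s, t)) - f w - l * (w + cexp (s, t) - w)) * cexp (- (s, t)))%C.
      2:{ replace l with (l * 1)%C at 2 by ring. rewrite <- En. ring. }
      assert (Q : Cmod (w + cexp (s, t) - w) = exp s).
      { replace (w + cexp (s, t) - w)%C with (cexp (s, t)) by ring. apply Cmod_cexp. }
      rewrite Cmod_mult, Cmod_cexp. replace (Re (- (s, t))) with (- s) by reflexivity.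
      assert (K := Hd2 (w + cexp (s, t))%C). rewrite Q in K. specialize (K Hsd).
      rewrite exp_Ropp. pose proof (exp_pos s).
      apply Rmult_le_reg_r with (exp s); [assumption |].
      rewrite Rmult_assoc, Rinv_l by lra. lra. }
    rewrite (Vc s Hs) in B2.
    assert (B3 : Cmod (RtoC (2 * PI - 0) * l) <= (2 * PI - 0) * (2 * B / r + eps)).
    { replace (RtoC (2 * PI - 0) * l)%C
        with (V s1 + - (V s1 - RtoC (2 * PI - 0) * l))%C by ring.
      eapply Rle_trans; [apply Cmod_triangle |]. rewrite Cmod_opp. lra. }
    rewrite Cmod_mult, Cmod_R, Rabs_right in B3 by lra.
    apply Rmult_le_reg_l with (2 * PI - 0); [lra | exact B3]. }
  apply le_epsilon. exact Main.
Qed.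

(** * The norm of H^2 *)

Definition holo (f : C -> C) : Prop :=
  forall w : C, 0 < Re w -> exists l, cderiv f w l.

Lemma holo_iff (f : C -> C) : holo f <-> holomorphic_on_Cplus f.
Proof.
  split; intros H w Hw; destruct (H w Hw) as [l Hl]; exists l; apply is_derive_iff_cderiv; exact Hl.
Qed.

Lemma holo_ccont (f : C -> C) (w : C) : holo f -> 0 < Re w -> ccont f w.
Proof. intros H Hw. destruct (H w Hw) as [l Hl]. eapply cderiv_ccont, Hl. Qed.

Lemma holo_plus (f g : C -> C) : holo f -> holo g -> holo (fun w => f w + g w)%C.
Proof.
  intros Hf Hg w Hw. destruct (Hf w Hw) as [l Hl], (Hg w Hw) as [m Hm].
  exists (l + m)%C. apply cderiv_plus; assumption.
Qed.

Lemma holo_minus (f g : C -> C) : holo f -> holo g -> holo (fun w => f w - g w)%C.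
Proof.
  intros Hf Hg w Hw. destruct (Hf w Hw) as [l Hl], (Hg w Hw) as [m Hm].
  exists (l - m)%C. apply cderiv_minus; assumption.
Qed.

Lemma holo_scal (c : C) (f : C -> C) : holo f -> holo (fun w => c * f w)%C.
Proof.
  intros Hf w Hw. destruct (Hf w Hw) as [l Hl]. exists (c * l)%C. apply cderiv_scal, Hl.
Qed.

Lemma holo_opp (f : C -> C) : holo f -> holo (fun w => - f w)%C.
Proof.
  intros Hf w Hw. destruct (Hf w Hw) as [l Hl]. exists (- (1) * l)%C.
  apply (cderiv_ext (fun u => - (1) * f u)%C); [intros; ring |]. apply cderiv_scal, Hl.
Qed.

Lemma Cmod_triangle_rev (u v : C) : Rabs (Cmod u - Cmod v) <= Cmod (u - v).
Proof.
  assert (T1 := Cmod_triangle (u - v) v). assert (T2 := Cmod_triangle (- (u - v)) u).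
  rewrite Cmod_opp in T2.
  replace (u - v + v)%C with u in T1 by ring.
  replace (- (u - v) + u)%C with v in T2 by ring.
  apply Rabs_le. lra.
Qed.

Definition sqmod (f : C -> C) (x y : R) : R := Cmod (f (x, y)) ^ 2.

Lemma sqmod_pos (f : C -> C) (x y : R) : 0 <= sqmod f x y.
Proof. apply pow2_ge_0. Qed.

Lemma sqmod_cont (f : C -> C) (x y : R) : holo f -> 0 < x -> continuous (sqmod f x) y.
Proof.
  intros Hf Hx.
  assert (K : continuous (fun t => Cmod (f (x, t))) y).
  { apply filterlim_locally. intros eps.
    destruct (proj1 (path_cont_iff (fun t => f (x, t)) y)
      (ccont_path f (fun t => (x, t)) y (holo_ccont f (x, y) Hf Hx) (path_cont_v x y))
      eps (cond_pos eps)) as [d [Hd1 Hd2]].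
    exists (mkposreal d Hd1). intros u Hu. specialize (Hd2 u Hu). cbv beta in Hd2.
    change (Rabs (Cmod (f (x, u)) - Cmod (f (x, y))) < eps).
    eapply Rle_lt_trans; [| exact Hd2].
    apply Cmod_triangle_rev. }
  apply (continuous_ext (fun t => mult (Cmod (f (x, t))) (Cmod (f (x, t))))).
  - intros t. unfold sqmod, mult; simpl. ring.
  - apply (continuous_mult (K := R_AbsRing)); exact K.
Qed.

Lemma sqmod_ex_RInt (f : C -> C) (x a b : R) : holo f -> 0 < x -> ex_RInt (sqmod f x) a b.
Proof.
  intros Hf Hx. apply (ex_RInt_continuous (V := R_CompleteNormedModule)).
  intros; apply sqmod_cont; assumption.
Qed.

Lemma sqmod_RInt_mono (f : C -> C) (x a b c d : R) :
  holo f -> 0 < x -> a <= c -> c <= d -> d <= b ->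
  RInt (sqmod f x) c d <= RInt (sqmod f x) a b.
Proof.
  intros Hf Hx H1 H2 H3.
  assert (E : forall u v, ex_RInt (sqmod f x) u v) by (intros; apply sqmod_ex_RInt; assumption).
  assert (P : forall u v, u <= v -> 0 <= RInt (sqmod f x) u v).
  { intros u v Huv. apply RInt_ge_0; [exact Huv | apply E |]. intros; apply sqmod_pos. }
  assert (C1 := RInt_Chasles (sqmod f x) a c b (E _ _) (E _ _)).
  assert (C2 := RInt_Chasles (sqmod f x) c d b (E _ _) (E _ _)).
  unfold plus in *; simpl in *. pose proof (P a c H1). pose proof (P d b H3). lra.
Qed.

Definition seg_le (f : C -> C) (x T A : R) : Prop := RInt (sqmod f x) (- T) T <= PI * A ^ 2.

(** For [A >= 0] and holomorphic [f] this is [||f|| <= A], freed of extended reals and square roots.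
    Restricting to [0 <= T] loses nothing, because a reversed segment has an integral at most 0. *)
Definition h2le (f : C -> C) (A : R) : Prop :=
  forall x T : R, 0 < x -> 0 <= T -> seg_le f x T A.

Lemma h2_normsq_le_iff (f : C -> C) (A : R) :
  holo f -> (Rbar_le (h2_normsq f) (Finite (A ^ 2)) <-> h2le f A).
Proof.
  intros Hf. pose proof PI_RGT_0 as HPI.
  destruct (Lub_Rbar_correct (fun r : R => exists x T : R, 0 < x /\
     r = / PI * RInt (fun y : R => (Cmod (f (x, y))) ^ 2) (- T) T)) as [U L].
  split.
  - intros H x T Hx HT. unfold seg_le.
    assert (K : Rbar_le (/ PI * RInt (sqmod f x) (- T) T) (A ^ 2)).
    { eapply Rbar_le_trans; [| exact H]. apply U. exists x, T. split; [exact Hx | reflexivity]. }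
    simpl in K. apply (Rmult_le_compat_l PI) in K; [| lra].
    rewrite <- Rmult_assoc, Rinv_r, Rmult_1_l in K by lra. exact K.
  - intros H. apply L. intros r [x [T [Hx ->]]].
    change (/ PI * RInt (sqmod f x) (- T) T <= A ^ 2).
    assert (K : RInt (sqmod f x) (- T) T <= PI * A ^ 2).
    { destruct (Rle_dec 0 T) as [HT | HT]; [apply H; assumption |].
      (* The supremum in the norm also ranges over [T < 0], where the integral is minus a
         nonnegative one. *)
      assert (S := opp_RInt_swap (V := R_CompleteNormedModule) (sqmod f x) T (- T)
        (sqmod_ex_RInt f x _ _ Hf Hx)).
      assert (P : 0 <= RInt (sqmod f x) T (- T)).
      { apply RInt_ge_0; [lra | apply sqmod_ex_RInt; assumption |]. intros; apply sqmod_pos. }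
      unfold opp in S; simpl in S. pose proof (pow2_ge_0 A). nra. }
    apply Rmult_le_reg_l with PI; [lra |].
    rewrite <- Rmult_assoc, Rinv_r, Rmult_1_l by lra. exact K.
Qed.

(** The degenerate segment [T = 0] contributes 0; in particular the least upper bound is never
    [m_infty]. *)
Lemma h2_normsq_ge_0 (f : C -> C) : Rbar_le 0 (h2_normsq f).
Proof.
  apply Lub_Rbar_correct. exists 1, 0. split; [lra |].
  rewrite Ropp_0, (RInt_point (V := R_CompleteNormedModule)).
  unfold zero; simpl. ring.
Qed.

Lemma h2_norm_le_iff (f : C -> C) (A : R) :
  holo f -> 0 <= A -> (Rbar_le (h2_norm f) (Finite A) <-> h2le f A).
Proof.
  intros Hf HA. rewrite <- h2_normsq_le_iff by exact Hf.
  pose proof (h2_normsq_ge_0 f) as P. unfold h2_norm.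
  destruct (h2_normsq f) as [r | |]; simpl in *; [| tauto | tauto].
  split; intros H.
  - replace r with (sqrt r ^ 2) by (simpl; rewrite Rmult_1_r; apply sqrt_sqrt; exact P).
    pose proof (sqrt_pos r). simpl; nra.
  - rewrite <- (sqrt_pow2 A HA). apply sqrt_le_1_alt. simpl; lra.
Qed.

Lemma in_H2_iff (f : C -> C) : in_H2 f <-> holo f /\ exists A, 0 < A /\ h2le f A.
Proof.
  unfold in_H2. rewrite <- holo_iff. split; intros [Hf H]; split; auto.
  - pose proof (h2_normsq_ge_0 f) as P.
    unfold is_finite in H.
    (* [(1 + r)^2 >= r] for [r >= 0], and the added 1 keeps the bound strictly positive, as the
       Minkowski inequality below requires. *)
    exists (1 + real (h2_normsq f)). rewrite <- H in P. simpl in P. split; [lra |].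
    apply h2_normsq_le_iff; [exact Hf |]. rewrite <- H. simpl. nra.
  - destruct H as [A [HA H]]. apply (h2_normsq_le_iff f A Hf) in H.
    pose proof (h2_normsq_ge_0 f) as P. unfold is_finite.
    destruct (h2_normsq f); simpl in *; tauto.
Qed.

Lemma seg_le_ext (f g : C -> C) (x T A : R) :
  (forall w, f w = g w) -> seg_le f x T A -> seg_le g x T A.
Proof.
  intros E H. unfold seg_le in *.
  rewrite (RInt_ext (V := R_CompleteNormedModule) (sqmod g x) (sqmod f x)); [exact H |].
  intros y _. unfold sqmod. rewrite E. reflexivity.
Qed.

Lemma h2le_ext (f g : C -> C) (A : R) :
  (forall w, f w = g w) -> h2le f A -> h2le g A.
Proof. intros E H x T Hx HT. eapply seg_le_ext; [exact E | apply H; assumption]. Qed.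

Lemma seg_le_bound (f : C -> C) (x T A M : R) :
  holo f -> 0 < x -> 0 <= T -> (forall y, - T <= y <= T -> Cmod (f (x, y)) <= M) ->
  2 * T * M ^ 2 <= PI * A ^ 2 -> seg_le f x T A.
Proof.
  intros Hf Hx HT HM HA. unfold seg_le. eapply Rle_trans; [| exact HA].
  replace (2 * T * M ^ 2) with (RInt (fun _ => M ^ 2) (- T) T)
    by (rewrite (RInt_const (V := R_CompleteNormedModule)); unfold scal; simpl; unfold mult; simpl; ring).
  apply RInt_le; [lra | apply sqmod_ex_RInt; assumption | apply ex_RInt_const |].
  intros y Hy. unfold sqmod. apply pow_incr. split; [apply Cmod_ge_0 | apply HM; lra].
Qed.

Lemma h2le_zero : h2le (fun _ => 0%C) 0.
Proof.
  intros x T Hx HT. apply seg_le_bound with 0; try assumption; [| | lra].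
  - intros w _. exists 0%C. apply cderiv_const.
  - intros y _. rewrite Cmod_0. lra.
Qed.

Lemma h2le_weaken (f : C -> C) (A B : R) : 0 <= A -> A <= B -> h2le f A -> h2le f B.
Proof.
  intros HA HB H x T Hx HT. eapply Rle_trans; [apply (H x T Hx HT) |].
  pose proof PI_RGT_0. apply Rmult_le_compat_l; [lra |]. apply pow_incr; lra.
Qed.

(* Minkowski without Cauchy-Schwarz:
   [|u + v|^2 <= (1 + t) |u|^2 + (1 + 1/t) |v|^2] with [t = B / A]. *)
Lemma seg_le_plus (f g : C -> C) (x T A B : R) :
  holo f -> holo g -> 0 < x -> 0 <= T -> 0 < A -> 0 < B ->
  seg_le f x T A -> seg_le g x T B -> seg_le (fun w => f w + g w)%C x T (A + B).
Proof.
  intros Hf Hg Hx HT HA HB H1 H2. unfold seg_le in *.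
  assert (E1 := sqmod_ex_RInt f x (- T) T Hf Hx).
  assert (E2 := sqmod_ex_RInt g x (- T) T Hg Hx).
  set (p := 1 + B / A). set (q := 1 + A / B).
  assert (P0 : 0 < B / A) by (apply Rdiv_lt_0_compat; assumption).
  assert (Q0 : 0 < A / B) by (apply Rdiv_lt_0_compat; assumption).
  apply Rle_trans with (p * RInt (sqmod f x) (- T) T + q * RInt (sqmod g x) (- T) T).
  - assert (S1 := RInt_scal (V := R_CompleteNormedModule) (sqmod f x) (- T) T p E1).
    assert (S2 := RInt_scal (V := R_CompleteNormedModule) (sqmod g x) (- T) T q E2).
    assert (F1 := ex_RInt_scal (V := R_CompleteNormedModule) (sqmod f x) (- T) T p E1).
    assert (F2 := ex_RInt_scal (V := R_CompleteNormedModule) (sqmod g x) (- T) T q E2).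
    assert (S3 : RInt (fun y => p * sqmod f x y + q * sqmod g x y) (- T) T
      = p * RInt (sqmod f x) (- T) T + q * RInt (sqmod g x) (- T) T).
    { transitivity (plus (RInt (fun y => scal p (sqmod f x y)) (- T) T)
                         (RInt (fun y => scal q (sqmod g x y)) (- T) T)).
      - apply (RInt_plus (V := R_CompleteNormedModule) _ _ (- T) T F1 F2).
      - exact (f_equal2 Rplus S1 S2). }
    rewrite <- S3.
    apply RInt_le; [lra | apply (sqmod_ex_RInt (fun w => f w + g w)%C); auto using holo_plus | |].
    { apply (ex_RInt_plus (V := R_CompleteNormedModule) _ _ (- T) T F1 F2). }
    intros y _. unfold sqmod, p, q.
    set (u := Cmod (f (x, y))). set (v := Cmod (g (x, y))).
    assert (T1 : Cmod (f (x, y) + g (x, y)) <= u + v) by apply Cmod_triangle.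
    pose proof (Cmod_ge_0 (f (x, y) + g (x, y))) as T0.
    apply Rle_trans with ((u + v) ^ 2); [apply pow_incr; lra |].
    assert (K : 0 <= (u * B - v * A) ^ 2 / (A * B)).
    { apply Rdiv_le_0_compat; [apply pow2_ge_0 | apply Rmult_lt_0_compat; assumption]. }
    apply Rminus_le_0.
    replace (_ - _) with ((u * B - v * A) ^ 2 / (A * B)) by (field; lra). exact K.
  - apply Rle_trans with (p * (PI * A ^ 2) + q * (PI * B ^ 2)).
    + apply Rplus_le_compat; apply Rmult_le_compat_l; auto; unfold p, q; lra.
    + right. unfold p, q. field. lra.
Qed.

Lemma h2le_plus (f g : C -> C) (A B : R) :
  holo f -> holo g -> 0 < A -> 0 < B ->
  h2le f A -> h2le g B -> h2le (fun w => f w + g w)%C (A + B).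
Proof. intros ? ? ? ? H1 H2 x T Hx HT. apply seg_le_plus; auto. Qed.

Lemma h2le_scal (c : C) (f : C -> C) (A : R) :
  holo f -> h2le f A -> h2le (fun w => c * f w)%C (Cmod c * A).
Proof.
  intros Hf H x T Hx HT. unfold seg_le.
  assert (S : RInt (sqmod (fun w => c * f w)%C x) (- T) T
    = Cmod c ^ 2 * RInt (sqmod f x) (- T) T).
  { etransitivity; [| apply (RInt_scal (V := R_CompleteNormedModule) (sqmod f x) (- T) T
      (Cmod c ^ 2) (sqmod_ex_RInt f x _ _ Hf Hx))].
    apply (RInt_ext (V := R_CompleteNormedModule)). intros y _. unfold sqmod.
    rewrite Cmod_mult. apply Rpow_mult_distr. }
  rewrite S, Rpow_mult_distr. specialize (H x T Hx HT). unfold seg_le in H.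
  pose proof (pow2_ge_0 (Cmod c)) as K.
  apply (Rmult_le_compat_l _ _ _ K) in H. lra.
Qed.

Lemma h2le_opp (f : C -> C) (A : R) : h2le f A -> h2le (fun w => - f w)%C A.
Proof.
  intros H x T Hx HT. unfold seg_le.
  rewrite (RInt_ext (V := R_CompleteNormedModule) _ (sqmod f x)).
  - apply H; assumption.
  - intros y _. unfold sqmod. rewrite Cmod_opp. reflexivity.
Qed.

(** * Pointwise bounds in H^2 *)

Lemma is_CInt_swap (f : R -> C) (a b : R) (l : C) : is_CInt f b a l -> is_CInt f a b (- l)%C.
Proof. apply (@is_RInt_swap C_R_NormedModule). Qed.

Lemma hseg_CInt_holo (f : C -> C) (a b y : R) :
  holo f -> 0 < Rmin a b ->
  is_CInt (fun x => f (x, y)) a b (CInt (fun x => f (x, y)) a b).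
Proof.
  intros Hf H. apply is_CInt_CInt_unordered. intros t Ht.
  apply (ccont_path f (fun u => (u, y))); [| apply path_cont_h].
  apply holo_ccont; [exact Hf | simpl; lra].
Qed.

Lemma vseg_CInt_holo (f : C -> C) (a b x : R) :
  holo f -> 0 < x ->
  is_CInt (fun y => f (x, y)) a b (CInt (fun y => f (x, y)) a b).
Proof.
  intros Hf H. apply is_CInt_CInt_unordered. intros t Ht.
  apply (ccont_path f (fun u => (x, u))); [| apply path_cont_v].
  apply holo_ccont; [exact Hf | exact H].
Qed.

(** The abscissae may come in either order, because it is applied to [Re z] and the abscissa of a
    nearby point on either side of it. *)
Lemma goursat_holo (f : C -> C) (a b c d : R) :
  holo f -> 0 < Rmin a b -> c <= d -> rect_int f a b c d = 0%C.
Proof.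
  intros Hf H Hcd.
  assert (K : forall a b, 0 < a -> a <= b -> rect_int f a b c d = 0%C).
  { intros u v Hu Huv. apply goursat; auto. intros z [Hz _]. apply Hf. lra. }
  destruct (Rle_dec a b) as [Hab | Hab].
  - apply K; [rewrite Rmin_left in H by lra; exact H | exact Hab].
  - rewrite Rmin_right in H by lra.
    assert (E := K b a H ltac:(lra)). unfold rect_int in *.
    assert (Sw : forall y, CInt (fun x => f (x, y)) a b = (- CInt (fun x => f (x, y)) b a)%C).
    { intros y. apply (@is_RInt_unique C_R_CompleteNormedModule), is_CInt_swap.
      apply hseg_CInt_holo; [exact Hf |]. rewrite Rmin_left by lra. exact H. }
    rewrite !Sw. match type of E with ?e = _ => transitivity (- e)%C; [ring | rewrite E; ring] end.
Qed.

Lemma Rabs_between (a b t : R) : Rmin a b <= t <= Rmax a b -> Rabs (t - a) <= Rabs (b - a).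
Proof.
  unfold Rmin, Rmax. destruct (Rle_dec a b); intros H; unfold Rabs;
    destruct (Rcase_abs (t - a)), (Rcase_abs (b - a)); lra.
Qed.

(* Goursat turns the difference of the two vertical integrals into horizontal ones. *)
Lemma cderiv_vertical_integral (f : C -> C) (tau : R) (z : C) :
  holo f -> 0 <= tau -> 0 < Re z ->
  cderiv (fun u => CInt (fun y => f (Re u, y)) (Im u) (Im u + tau)) z
    (- Ci * (f (Re z, (Im z + tau)%R) - f z))%C.
Proof.
  intros Hf Ht Hz eps Heps. destruct z as [x y]. simpl Re in *. simpl Im in *.
  (* Four short segments contribute: two horizontal and two vertical, near [z] and near
     [z + i tau]. *)
  assert (He : 0 < eps / 4) by lra.
  destruct (holo_ccont f (x, y) Hf Hz _ He) as [d1 [Hd1 H1]].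
  destruct (holo_ccont f (x, y + tau) Hf Hz _ He) as [d2 [Hd2 H2]].
  set (d := Rmin (Rmin d1 d2) x).
  assert (D1 : d <= d1) by (eapply Rle_trans; apply Rmin_l).
  assert (D2 : d <= d2) by (eapply Rle_trans; [apply Rmin_l | apply Rmin_r]).
  assert (D3 : d <= x) by apply Rmin_r.
  assert (D0 : 0 < d) by (repeat apply Rmin_pos; assumption).
  exists (d / 2). split; [lra |].
  intros [x' y'] Hc. simpl Re. simpl Im.
  assert (Lx : Rabs (x' - x) <= Cmod ((x', y') - (x, y))) by apply (re_le_Cmod ((x', y') - (x, y))).
  assert (Ly : Rabs (y' - y) <= Cmod ((x', y') - (x, y))) by apply (im_le_Cmod ((x', y') - (x, y))).
  set (m := Cmod ((x', y') - (x, y))) in *.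
  assert (Hmin : 0 < Rmin x x').
  { apply Rmin_pos; [exact Hz |]. assert (K := Rle_abs (- (x' - x))). rewrite Rabs_Ropp in K. lra. }
  assert (Hx' : 0 < x') by (eapply Rlt_le_trans; [exact Hmin | apply Rmin_r]).
  assert (near : forall u v c, Rabs (u - x) <= m -> Rabs (v - c) <= m -> Cmod ((u, v) - (x, c)) < d).
  { intros u v c Hu Hv. eapply Rle_lt_trans; [apply Cmod_le_Rabs |]. simpl.
    unfold Rminus in Hu, Hv. lra. }
  (* By continuity of [f], an integral over a short segment is its length times the value at
     [(x, c)], up to [eps / 4] times the length. [BV] is the vertical analogue. *)
  assert (BH : forall c d', d <= d' -> (forall u, Cmod (u - (x, c)) < d' -> Cmod (f u - f (x, c)) < eps / 4) ->
    Cmod (CInt (fun t => f (t, c)) x x' - RtoC (x' - x) * f (x, c)) <= Rabs (x' - x) * (eps / 4)).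
  { intros c d' Hd' Hcl. eapply is_CInt_bound_abs;
      [| apply is_CInt_minus; [apply hseg_CInt_holo; assumption | apply is_CInt_const]].
    intros t Ht'. apply Rlt_le, Hcl. apply Rabs_between in Ht'.
    eapply Rlt_le_trans; [apply near |exact Hd']; [lra |].
    rewrite Rminus_diag, Rabs_R0. apply Cmod_ge_0. }
  assert (BV : forall c d', d <= d' -> (forall u, Cmod (u - (x, c)) < d' -> Cmod (f u - f (x, c)) < eps / 4) ->
    Cmod (CInt (fun t => f (x', t)) c (c + (y' - y)) - RtoC (c + (y' - y) - c) * f (x, c))
      <= Rabs (c + (y' - y) - c) * (eps / 4)).
  { intros c d' Hd' Hcl. eapply is_CInt_bound_abs;
      [| apply is_CInt_minus; [apply vseg_CInt_holo; assumption | apply is_CInt_const]].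
    intros t Ht'. apply Rlt_le, Hcl. apply Rabs_between in Ht'.
    replace (c + (y' - y) - c) with (y' - y) in Ht' by ring.
    eapply Rlt_le_trans; [apply near |exact Hd']; lra. }
  assert (A1 := BH y d1 D1 H1). assert (A2 := BH (y + tau) d2 D2 H2).
  assert (A3 := BV y d1 D1 H1). assert (A4 := BV (y + tau) d2 D2 H2).
  replace (y + (y' - y)) with y' in A3 by ring.
  replace (y + tau + (y' - y)) with (y' + tau) in A4 by ring.
  replace (y' + tau - (y + tau)) with (y' - y) in A4 by ring.
  set (h0 := CInt (fun t => f (t, y)) x x') in *.
  set (h1 := CInt (fun t => f (t, y + tau)) x x') in *.
  set (v0 := CInt (fun t => f (x', t)) y y') in *.
  set (v1 := CInt (fun t => f (x', t)) (y + tau) (y' + tau)) in *.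
  assert (G := goursat_holo f x x' y (y + tau) Hf Hmin ltac:(lra)).
  unfold rect_int in G. fold h0 in G. fold h1 in G.
  set (F0 := CInt (fun t => f (x, t)) y (y + tau)) in *.
  set (F1 := CInt (fun t => f (x', t)) y (y + tau)) in *.
  (* Moving the window from [y] to [y'] gains the piece [v1] at the top and loses [v0] at the
     bottom. *)
  assert (E1 : CInt (fun t => f (x', t)) y' (y' + tau) = (F1 + v1 - v0)%C).
  { eapply is_CInt_unique; [apply vseg_CInt_holo; assumption |].
    replace (F1 + v1 - v0)%C with (- v0 + (F1 + v1))%C by ring.
    apply is_CInt_Chasles with y; [apply is_CInt_swap, vseg_CInt_holo; assumption |].
    apply is_CInt_Chasles with (y + tau); apply vseg_CInt_holo; assumption. }
  assert (Ci2 : (Ci * Ci)%C = (- (1))%C).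
  { unfold Ci, Cmult, Copp, RtoC; simpl; f_equal; ring. }
  assert (E2 : (F1 - F0)%C = (- Ci * (h1 - h0))%C).
  { replace (F1 - F0)%C with (- (- (1)) * (F1 - F0))%C by ring. rewrite <- Ci2.
    replace (- (Ci * Ci) * (F1 - F0))%C
      with (- Ci * (h0 + Ci * F1 - h1 - Ci * F0) + - Ci * (h1 - h0))%C by ring.
    rewrite G. ring. }
  rewrite E1.
  replace ((x', y') - (x, y))%C with (RtoC (x' - x) + Ci * RtoC (y' - y))%C
    by (unfold RtoC, Ci, Cminus, Cplus, Copp, Cmult; simpl; f_equal; ring).
  replace (F1 + v1 - v0 - F0)%C with ((F1 - F0) + v1 - v0)%C by ring. rewrite E2.
  set (p := f (x, y)) in *. set (q := f (x, (y + tau)%R)) in *.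
  (* The four small errors are isolated; the rest carries the factor [1 + i^2 = 0]. So horizontal
     and vertical displacements give the same derivative. *)
  match goal with |- Cmod ?e <= _ => replace e with
    ((v1 - RtoC (y' - y) * q) + Ci * (h0 - RtoC (x' - x) * p) - (v0 - RtoC (y' - y) * p)
     - Ci * (h1 - RtoC (x' - x) * q) + (1 + Ci * Ci) * (RtoC (y' - y) * (q - p)))%C by ring end.
  rewrite Ci2. replace (1 + - (1))%C with (RtoC 0) by ring.
  rewrite Cmult_0_l, Cplus_0_r.
  eapply Rle_trans; [apply Cmod_4 |]. clear - A1 A2 A3 A4 Lx Ly Heps.
  assert (Rabs (x' - x) * (eps / 4) <= m * (eps / 4)) by (apply Rmult_le_compat_r; lra).
  assert (Rabs (y' - y) * (eps / 4) <= m * (eps / 4)) by (apply Rmult_le_compat_r; lra).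
  replace (Cmod (RtoC (x' - x) + Ci * RtoC (y' - y))) with m.
  - lra.
  - unfold m. f_equal. unfold RtoC, Ci, Cminus, Cplus, Copp, Cmult; simpl; f_equal; ring.
Qed.

(* AM-GM in place of Cauchy-Schwarz: [|f| <= (A + |f|^2 / A) / 2]. *)
Lemma h2_vertical_integral_bound (f : C -> C) (A x y0 y1 : R) :
  holo f -> 0 < A -> h2le f A -> 0 < x -> y0 <= y1 <= y0 + 1 ->
  Cmod (CInt (fun y => f (x, y)) y0 y1) <= 3 * A.
Proof.
  intros Hf HA H Hx Hy.
  set (T := Rabs y0 + Rabs y1).
  pose proof (Rabs_pos y0). pose proof (Rabs_pos y1).
  pose proof (Rle_abs y0). pose proof (Rle_abs y1).
  pose proof (Rle_abs (- y0)). pose proof (Rle_abs (- y1)). rewrite !Rabs_Ropp in *.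
  assert (K : RInt (sqmod f x) y0 y1 <= PI * A ^ 2).
  { eapply Rle_trans; [| apply (H x T); unfold T; lra].
    apply sqmod_RInt_mono; try assumption; unfold T; lra. }
  assert (E := sqmod_ex_RInt f x y0 y1 Hf Hx).
  assert (I1 : is_RInt (fun y => plus (A / 2) (scal (/ (2 * A)) (sqmod f x y))) y0 y1
     (plus (scal (y1 - y0) (A / 2)) (scal (/ (2 * A)) (RInt (sqmod f x) y0 y1)))).
  { apply (is_RInt_plus (V := R_NormedModule)); [apply (is_RInt_const (V := R_NormedModule)) |].
    apply (is_RInt_scal (V := R_NormedModule)), (RInt_correct (V := R_CompleteNormedModule)), E. }
  assert (I2 := vseg_CInt_holo f y0 y1 x Hf Hx).
  rewrite Cmod_norm.
  eapply Rle_trans; [eapply (@norm_RInt_le C_R_NormedModule); [| | exact I2 | exact I1]; [lra |] |].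
  - intros y _. pose proof (Cmod_norm (f (x, y))) as N.
    eapply Rle_trans; [right; symmetry; exact N |].
    change (Cmod (f (x, y)) <= A / 2 + / (2 * A) * Cmod (f (x, y)) ^ 2).
    set (u := Cmod (f (x, y))). apply Rminus_le_0.
    replace (_ - _) with ((A - u) ^ 2 / (2 * A)) by (field; lra).
    apply Rdiv_le_0_compat; [apply pow2_ge_0 | lra].
  - unfold plus, scal; simpl; unfold mult; simpl.
    (* The two terms are [A / 2] and [PI / 2 * A]; with [PI <= 4] their sum is below [3 * A]. *)
    apply Rle_trans with (1 * (A / 2) + / (2 * A) * (PI * A ^ 2)).
    + apply Rplus_le_compat; [apply Rmult_le_compat_r; lra |].
      apply Rmult_le_compat_l; [apply Rlt_le, Rinv_0_lt_compat; lra | exact K].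
    + pose proof PI_4. replace (/ (2 * A) * (PI * A ^ 2)) with (PI / 2 * A) by (field; lra). nra.
Qed.

(* The vertical averages [F u] of [f] are holomorphic and bounded by [3 A], so Cauchy's
   estimate bounds [F' u = - i (f (u + i tau) - f u)]; thus [f z] is close to its
   average over [z, z + i]. *)
Lemma h2_point_bound (f : C -> C) (A : R) (z : C) :
  holo f -> 0 < A -> h2le f A -> 0 < Re z -> Cmod (f z) <= (3 + 12 / Re z) * A.
Proof.
  intros Hf HA H Hz.
  assert (Osc : forall tau, 0 <= tau <= 1 ->
    Cmod (f (Re z, Im z + tau) - f z) <= 12 / Re z * A).
  { intros tau Ht.
    assert (L := cderiv_vertical_integral f tau z Hf ltac:(lra) Hz).
    assert (near : forall u, Cmod (u - z) <= Re z / 2 -> 0 < Re u).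
    { intros u Hu. pose proof (re_le_Cmod (u - z)) as K.
      pose proof (Rle_abs (- Re (u - z))) as K2. rewrite Rabs_Ropp in K2.
      destruct u, z; simpl in *. lra. }
    apply cauchy_estimate with (r := Re z / 2) (B := 3 * A) in L; [| lra | |].
    - rewrite Cmod_mult, Cmod_opp, Cmod_Ci, Rmult_1_l in L.
      eapply Rle_trans; [exact L |]. right. field. lra.
    - intros u Hu. eexists. apply cderiv_vertical_integral; [exact Hf | lra | apply near, Hu].
    - intros u Hu. apply h2_vertical_integral_bound; auto. lra. }
  assert (I := vseg_CInt_holo f (Im z) (Im z + 1) (Re z) Hf Hz).
  assert (B1 := h2_vertical_integral_bound f A (Re z) (Im z) (Im z + 1) Hf HA H Hz ltac:(lra)).
  assert (B2 : Cmod (CInt (fun y => f (Re z, y)) (Im z) (Im z + 1)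
                 - RtoC (Im z + 1 - Im z) * f z) <= (Im z + 1 - Im z) * (12 / Re z * A)).
  { eapply is_CInt_bound; [lra | | apply is_CInt_minus; [exact I | apply is_CInt_const]].
    intros t Ht. replace t with (Im z + (t - Im z)) by ring. apply Osc. lra. }
  replace (Im z + 1 - Im z) with 1 in B2 by ring.
  set (J := CInt (fun y => f (Re z, y)) (Im z) (Im z + 1)) in *.
  replace (f z) with (J + - (J - 1 * f z))%C by ring.
  eapply Rle_trans; [apply Cmod_triangle |]. rewrite Cmod_opp. lra.
Qed.

(** Cauchy's estimate on the disc of radius [rho / 2]: it stays in [Re >= rho / 2], where [|f|] is
    at most [(3 + 24 / rho) * A], and [2 / (rho / 2) = 4 / rho]. *)
Lemma h2_deriv_bound (f : C -> C) (A rho : R) (z l : C) :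
  holo f -> 0 < A -> h2le f A -> 0 < rho -> rho <= Re z -> cderiv f z l ->
  Cmod l <= 4 * (3 + 24 / rho) / rho * A.
Proof.
  intros Hf HA H Hr Hz Hl.
  assert (near : forall u, Cmod (u - z) <= rho / 2 -> rho / 2 <= Re u).
  { intros u Hu. pose proof (re_le_Cmod (u - z)) as K.
    pose proof (Rle_abs (- Re (u - z))) as K2. rewrite Rabs_Ropp in K2.
    destruct u, z; simpl in *. lra. }
  apply cauchy_estimate with (r := rho / 2) (B := (3 + 24 / rho) * A) in Hl; [| lra | |].
  - eapply Rle_trans; [exact Hl |]. right. field. lra.
  - intros u Hu. apply Hf. specialize (near u Hu). lra.
  - intros u Hu. specialize (near u Hu).
    eapply Rle_trans; [apply (h2_point_bound f A); auto; lra |].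
    apply Rmult_le_compat_r; [lra |]. apply Rplus_le_compat_l.
    apply Rmult_le_reg_r with (Re u); [lra |].
    replace (12 / Re u * Re u) with 12 by (field; lra).
    apply Rle_trans with (24 / rho * (rho / 2)); [right; field; lra |].
    apply Rmult_le_compat_l; [| lra]. apply Rlt_le, Rdiv_lt_0_compat; lra.
Qed.

(** * Lipschitz bounds on half-planes, and limits of complex sequences *)

Lemma cderiv_Re_along (f : C -> C) (w h l : C) (t : R) :
  cderiv f (w + RtoC t * h)%C l ->
  is_derive (fun u => Re (f (w + RtoC u * h)%C)) t (Re (l * h)).
Proof.
  intros H. apply is_derive_Reals. intros eps Heps.
  pose proof (Cmod_ge_0 h) as H0.
  destruct (H (eps / (2 * (1 + Cmod h))) ltac:(apply Rdiv_lt_0_compat; lra)) as [d [Hd1 Hd2]].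
  assert (Hd : 0 < d / (1 + Cmod h)) by (apply Rdiv_lt_0_compat; lra).
  exists (mkposreal _ Hd). intros k Hk Hkd. simpl in Hkd.
  assert (Ek : (w + RtoC (t + k) * h - (w + RtoC t * h))%C = (RtoC k * h)%C).
  { rewrite RtoC_plus. ring. }
  specialize (Hd2 (w + RtoC (t + k) * h)%C). rewrite Ek, Cmod_mult, Cmod_R in Hd2.
  assert (K0 : 0 < Rabs k) by (apply Rabs_pos_lt, Hk).
  assert (Kd : Rabs k * Cmod h < d).
  { apply (Rmult_lt_compat_r (1 + Cmod h)) in Hkd; [| lra].
    unfold Rdiv in Hkd. rewrite Rmult_assoc, Rinv_l, Rmult_1_r in Hkd by lra. nra. }
  specialize (Hd2 Kd).
  set (D := (f (w + RtoC (t + k) * h) - f (w + RtoC t * h) - l * (RtoC k * h))%C) in *.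
  assert (ED : Re D = Re (f (w + RtoC (t + k) * h)%C) - Re (f (w + RtoC t * h)%C) - k * Re (l * h)).
  { unfold D. generalize (f (w + RtoC (t + k) * h)%C) (f (w + RtoC t * h)%C).
    intros [] []. destruct l, h. simpl. ring. }
  replace (_ - _) with (Re D / k) by (rewrite ED; field; exact Hk).
  unfold Rdiv. rewrite Rabs_mult, Rabs_inv.
  apply Rmult_lt_reg_r with (Rabs k); [exact K0 |].
  rewrite Rmult_assoc, Rinv_l by lra. rewrite Rmult_1_r.
  eapply Rle_lt_trans; [eapply Rle_trans; [apply re_le_Cmod | exact Hd2] |].
  apply Rle_lt_trans with (eps / 2 * Rabs k * (Cmod h / (1 + Cmod h))); [right; field; lra |].
  assert (Cmod h / (1 + Cmod h) <= 1).
  { apply Rmult_le_reg_r with (1 + Cmod h); [lra |].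
    unfold Rdiv. rewrite Rmult_assoc, Rinv_l by lra. lra. }
  assert (0 < eps / 2 * Rabs k) by (apply Rmult_lt_0_compat; lra). nra.
Qed.

(** The mean value theorem with equality holds for real functions only, hence the real part. *)
Lemma Re_increment_bound (f : C -> C) (w h : C) (K : R) :
  (forall t, 0 <= t <= 1 -> exists l, cderiv f (w + RtoC t * h)%C l /\ Cmod l <= K) ->
  Rabs (Re (f (w + h)%C) - Re (f w)) <= K * Cmod h.
Proof.
  intros H. set (g := fun u => Re (f (w + RtoC u * h)%C)).
  assert (D : forall t, 0 <= t <= 1 -> exists m, is_derive g t m /\ Rabs m <= K * Cmod h).
  { intros t Ht. destruct (H t Ht) as [l [Hl Bl]].
    exists (Re (l * h)). split; [apply cderiv_Re_along, Hl |].
    eapply Rle_trans; [apply re_le_Cmod |]. rewrite Cmod_mult.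
    apply Rmult_le_compat_r; [apply Cmod_ge_0 | exact Bl]. }
  destruct (MVT_gen g 0 1 (Derive g)) as [c [Hc E]].
  - rewrite Rmin_left, Rmax_right by lra. intros t Ht.
    destruct (D t ltac:(lra)) as [m [Hm _]]. apply Derive_correct. exists m; exact Hm.
  - rewrite Rmin_left, Rmax_right by lra. intros t Ht.
    destruct (D t ltac:(lra)) as [m [Hm _]].
    apply derivable_continuous_pt. exists m. apply is_derive_Reals, Hm.
  - rewrite Rmin_left, Rmax_right in Hc by lra.
    destruct (D c Hc) as [m [Hm Bm]].
    apply is_derive_unique in Hm. rewrite Hm in E.
    unfold g in E. replace (w + RtoC 1 * h)%C with (w + h)%C in E by ring.
    replace (w + RtoC 0 * h)%C with w in E by ring.
    rewrite E. rewrite Rminus_0_r, Rmult_1_r. exact Bm.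
Qed.

(** The half-plane is convex, so the derivative bound holds along the segment from [w] to [z]. The
    leading 2 adds the real part and the imaginary part, the latter being the real part of
    [- i f]. *)
Lemma h2_lipschitz (f : C -> C) (A rho : R) (z w : C) :
  holo f -> 0 < A -> h2le f A -> 0 < rho -> rho <= Re z -> rho <= Re w ->
  Cmod (f z - f w) <= 2 * (4 * (3 + 24 / rho) / rho * A) * Cmod (z - w).
Proof.
  intros Hf HA H Hr Hz Hw.
  set (K := 4 * (3 + 24 / rho) / rho * A).
  assert (seg : forall t, 0 <= t <= 1 -> rho <= Re (w + RtoC t * (z - w))).
  { intros t Ht. destruct z, w; simpl in *. nra. }
  assert (B1 : Rabs (Re (f (w + (z - w))%C) - Re (f w)) <= K * Cmod (z - w)).
  { apply Re_increment_bound. intros t Ht. specialize (seg t Ht).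
    destruct (Hf (w + RtoC t * (z - w))%C ltac:(lra)) as [l Hl]. exists l. split; [exact Hl |].
    eapply h2_deriv_bound; eauto. }
  assert (B2 : Rabs (Re (- Ci * f (w + (z - w)))%C - Re (- Ci * f w)%C) <= K * Cmod (z - w)).
  { apply (Re_increment_bound (fun u => - Ci * f u)%C). intros t Ht. specialize (seg t Ht).
    destruct (Hf (w + RtoC t * (z - w))%C ltac:(lra)) as [l Hl]. exists (- Ci * l)%C.
    split; [apply cderiv_scal, Hl |].
    rewrite Cmod_mult, Cmod_opp, Cmod_Ci, Rmult_1_l.
    eapply h2_deriv_bound; eauto. }
  replace (w + (z - w))%C with z in * by ring.
  eapply Rle_trans; [apply Cmod_le_Rabs |].
  replace (Re (f z - f w)) with (Re (f z) - Re (f w)) by (destruct (f z), (f w); reflexivity).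
  replace (Im (f z - f w)) with (Re (- Ci * f z)%C - Re (- Ci * f w)%C)
    by (destruct (f z), (f w); simpl; ring).
  lra.
Qed.

(** Besides giving a limit, it keeps the explicit rate [B n], so that the constants depending on
    [Re w] survive the passage to the limit. *)
Lemma C_cauchy_limit (u : nat -> C) (B : nat -> R) :
  is_lim_seq B 0 -> (forall n m, Cmod (u (n + m)%nat - u n) <= B n) ->
  exists l, forall n, Cmod (l - u n) <= B n.
Proof.
  intros HB Hu.
  assert (K : forall g : C -> R, (forall z w, Rabs (g z - g w) <= Cmod (z - w)) ->
    exists p : R, is_lim_seq (fun n => g (u n)) p).
  { intros g Hg.
    assert (Hc : ex_lim_seq_cauchy (fun n => g (u n))).
    { intros eps. apply is_lim_seq_spec in HB.
      destruct (HB (pos_div_2 eps)) as [N HN]. exists N. intros n m Hn Hm.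
      specialize (HN N (Nat.le_refl N)). simpl in HN. rewrite Rminus_0_r in HN.
      assert (Q : forall k, (N <= k)%nat -> Rabs (g (u k) - g (u N)) < eps / 2).
      { intros k Hk. eapply Rle_lt_trans; [apply Hg |].
        replace k with (N + (k - N))%nat by lia.
        eapply Rle_lt_trans; [apply Hu |]. eapply Rle_lt_trans; [apply Rle_abs | exact HN]. }
      pose proof (Q n Hn) as Q1. pose proof (Q m Hm) as Q2.
      replace (g (u n) - g (u m)) with ((g (u n) - g (u N)) - (g (u m) - g (u N))) by ring.
      eapply Rle_lt_trans; [apply Rabs_triang |]. rewrite Rabs_Ropp. lra. }
    apply ex_lim_seq_cauchy_corr in Hc. destruct Hc as [p Hp]. exists p. exact Hp. }
  destruct (K Re) as [p Hp].
  { intros z w. replace (Re z - Re w) with (Re (z - w)) by (destruct z, w; reflexivity).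
    apply re_le_Cmod. }
  destruct (K Im) as [q Hq].
  { intros z w. replace (Im z - Im w) with (Im (z - w)) by (destruct z, w; reflexivity).
    apply im_le_Cmod. }
  exists (p, q). intros n. apply le_epsilon. intros eps Heps.
  assert (He : 0 < eps / 2) by lra.
  apply is_lim_seq_spec in Hp. apply is_lim_seq_spec in Hq.
  destruct (Hp (mkposreal _ He)) as [N1 H1]. destruct (Hq (mkposreal _ He)) as [N2 H2].
  set (k := (n + (N1 + N2))%nat).
  specialize (H1 k ltac:(unfold k; lia)). specialize (H2 k ltac:(unfold k; lia)).
  simpl in H1, H2. specialize (Hu n (N1 + N2)%nat). fold k in Hu.
  replace ((p, q) - u n)%C with ((u k - u n) + - (u k - (p, q)))%C by ring.
  eapply Rle_trans; [apply Cmod_triangle |]. rewrite Cmod_opp.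
  assert (Cmod (u k - (p, q)) <= eps).
  { eapply Rle_trans; [apply Cmod_le_Rabs |].
    destruct (u k); simpl in *. unfold Rminus in H1, H2. lra. }
  lra.
Qed.

(** * Completeness of H^2 *)

Lemma lim_0_eventually_lt (A : nat -> R) (K eps : R) :
  is_lim_seq A 0 -> (forall n, 0 < A n) -> 0 < eps ->
  exists N, forall n, (N <= n)%nat -> K * A n < eps.
Proof.
  intros HA HP He.
  assert (He' : 0 < eps / (1 + Rabs K)).
  { pose proof (Rabs_pos K). apply Rdiv_lt_0_compat; lra. }
  apply is_lim_seq_spec in HA. destruct (HA (mkposreal _ He')) as [N HN].
  exists N. intros n Hn. specialize (HN n Hn). simpl in HN. specialize (HP n).
  rewrite Rminus_0_r, Rabs_right in HN by lra.
  pose proof (Rabs_pos K). pose proof (Rle_abs K).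
  apply (Rmult_lt_compat_r (1 + Rabs K)) in HN; [| lra].
  unfold Rdiv in HN. rewrite Rmult_assoc, Rinv_l, Rmult_1_r in HN by lra. nra.
Qed.

Section Completeness.

Variables (g : nat -> C -> C) (A : nat -> R).
Hypothesis g_holo : forall n, holo (g n).
Hypothesis A_pos : forall n, 0 < A n.
Hypothesis A_lim : is_lim_seq A 0.
Hypothesis g_cauchy : forall n m, h2le (fun w => g (n + m)%nat w - g n w)%C (A n).

Let d_holo n m : holo (fun w => g (n + m)%nat w - g n w)%C.
Proof. apply holo_minus; apply g_holo. Qed.

Lemma h2_pointwise_limit : exists x : C -> C, forall w n, 0 < Re w ->
  Cmod (x w - g n w) <= (3 + 12 / Re w) * A n.
Proof.
  assert (H : forall w, exists l, 0 < Re w -> forall n, Cmod (l - g n w) <= (3 + 12 / Re w) * A n).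
  (* Outside the right half-plane the limit gets the dummy value 0. *)
  { intros w. destruct (Rlt_dec 0 (Re w)) as [Hw | Hw]; [| exists 0%C; tauto].
    destruct (C_cauchy_limit (fun n => g n w) (fun n => (3 + 12 / Re w) * A n)) as [l Hl].
    - apply (is_lim_seq_scal_l A (3 + 12 / Re w)) in A_lim.
      replace (Rbar_mult (3 + 12 / Re w) 0) with (Finite 0) in A_lim
        by (simpl; f_equal; ring). exact A_lim.
    - intros n m. apply (h2_point_bound (fun u => g (n + m)%nat u - g n u)%C); auto.
    - exists l. auto. }
  exists (fun w => proj1_sig (constructive_indefinite_description _ (H w))).
  intros w n Hw. apply (proj2_sig (constructive_indefinite_description _ (H w)) Hw).
Qed.

Variable x : C -> C.
Hypothesis x_lim : forall w n, 0 < Re w -> Cmod (x w - g n w) <= (3 + 12 / Re w) * A n.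

(** The Lipschitz bound for [g (n + N) - g n] does not depend on [N] and passes to the pointwise
    limit. Its constant tends to 0 with [A n], which is what transfers differentiability to [x]. *)
Lemma limit_lipschitz (rho : R) (z w : C) (n : nat) :
  0 < rho -> rho <= Re z -> rho <= Re w ->
  Cmod ((x z - g n z) - (x w - g n w))
    <= 2 * (4 * (3 + 24 / rho) / rho * A n) * Cmod (z - w).
Proof.
  intros Hr Hz Hw. apply le_epsilon. intros eps Heps.
  destruct (lim_0_eventually_lt A (3 + 12 / Re z + (3 + 12 / Re w)) eps A_lim A_pos Heps)
    as [N HN].
  specialize (HN (n + N)%nat ltac:(lia)).
  assert (X1 := x_lim z (n + N)%nat ltac:(lra)). assert (X2 := x_lim w (n + N)%nat ltac:(lra)).
  assert (L := h2_lipschitz (fun u => g (n + N)%nat u - g n u)%C (A n) rho z w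
    (d_holo n N) (A_pos n) (g_cauchy n N) Hr Hz Hw). cbv beta in L.
  replace (x z - g n z - (x w - g n w))%C with
    ((g (n + N)%nat z - g n z - (g (n + N)%nat w - g n w))
     + ((x z - g (n + N)%nat z) + - (x w - g (n + N)%nat w)))%C by ring.
  eapply Rle_trans; [apply Cmod_triangle |].
  apply Rplus_le_compat; [exact L |].
  eapply Rle_trans; [apply Cmod_triangle |]. rewrite Cmod_opp. lra.
Qed.

Lemma limit_holo : holo x.
Proof.
  intros w Hw. set (rho := Re w / 2). assert (Hr : 0 < rho) by (unfold rho; lra).
  set (E := 4 * (3 + 24 / rho) / rho).
  assert (Hd : forall n, exists l, cderiv (g n) w l) by (intros n; apply g_holo, Hw).
  set (d := fun n => proj1_sig (constructive_indefinite_description _ (Hd n))).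
  assert (Dd : forall n, cderiv (g n) w (d n))
    by (intros n; exact (proj2_sig (constructive_indefinite_description _ (Hd n)))).
  destruct (C_cauchy_limit d (fun n => E * A n)) as [l Hl].
  { pose proof (is_lim_seq_scal_l A E 0 A_lim) as K.
    replace (Rbar_mult E 0) with (Finite 0) in K by (simpl; f_equal; ring). exact K. }
  { intros n m. apply (h2_deriv_bound (fun u => g (n + m)%nat u - g n u)%C (A n) rho w); auto.
    - unfold rho; lra.
    - apply cderiv_minus; apply Dd. }
  exists l. intros eps Heps.
  (* [2 * E * A n] pays for the increment of [x - g n], [E * A n] for replacing the slope [d n] by
     [l]; the other [eps / 2] is the differentiability error of [g n]. *)
  destruct (lim_0_eventually_lt A (2 * E + E) (eps / 2) A_lim A_pos ltac:(lra)) as [n Hn].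
  specialize (Hn n (Nat.le_refl n)). specialize (Hl n).
  destruct (Dd n (eps / 2) ltac:(lra)) as [r [Hr1 Hr2]].
  exists (Rmin r rho). split; [apply Rmin_pos; assumption |].
  intros z Hz.
  assert (Z1 : Cmod (z - w) < r) by (eapply Rlt_le_trans; [exact Hz | apply Rmin_l]).
  assert (Z2 : Cmod (z - w) < rho) by (eapply Rlt_le_trans; [exact Hz | apply Rmin_r]).
  assert (Rz : rho <= Re z).
  { pose proof (re_le_Cmod (z - w)) as K.
    pose proof (Rle_abs (- Re (z - w))) as K2. rewrite Rabs_Ropp in K2.
    unfold rho in *. destruct z, w; simpl in *. lra. }
  specialize (Hr2 z Z1).
  assert (L := limit_lipschitz rho z w n Hr Rz ltac:(unfold rho; lra)). fold E in L.
  replace (x z - x w - l * (z - w))%C with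
    ((x z - g n z - (x w - g n w)) + (g n z - g n w - d n * (z - w)) + - ((l - d n) * (z - w)))%C
    by ring.
  eapply Rle_trans; [apply Cmod_triangle |].
  eapply Rle_trans; [apply Rplus_le_compat_r, Cmod_triangle |].
  rewrite Cmod_opp, Cmod_mult. pose proof (Cmod_ge_0 (z - w)) as P.
  apply (Rmult_le_compat_r _ _ _ P) in Hl. nra.
Qed.

(** The pointwise rate depends only on [Re w], so convergence is uniform on each vertical segment
    and the integrals there pass to the limit, first with a slack [eta]. *)
Lemma limit_h2le (n : nat) : h2le (fun w => x w - g n w)%C (A n).
Proof.
  intros x0 T Hx HT.
  assert (Eta : forall eta, 0 < eta -> seg_le (fun w => x w - g n w)%C x0 T (A n + eta)).
  { intros eta Heta. pose proof PI_RGT_0 as HPI.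
    set (K := 3 + 12 / x0). assert (K0 : 0 < K).
    { assert (0 < 12 / x0) by (apply Rdiv_lt_0_compat; lra). unfold K; lra. }
    (* A function bounded by [e] on the segment has integral at most
       [2 * T * e^2 <= (2 * T + 1) * e], using [e <= 1]; the added 1 covers [T = 0]. *)
    set (e := Rmin 1 (PI * eta ^ 2 / (2 * T + 1))).
    assert (He : 0 < e).
    { apply Rmin_pos; [lra |]. apply Rdiv_lt_0_compat; [| lra].
      apply Rmult_lt_0_compat; [lra | apply pow_lt, Heta]. }
    destruct (lim_0_eventually_lt A K e A_lim A_pos He) as [N HN].
    specialize (HN (n + N)%nat ltac:(lia)).
    eapply (seg_le_ext (fun w => (g (n + N)%nat w - g n w) + (x w - g (n + N)%nat w))%C);
      [intros; ring |].
    apply (seg_le_plus (fun w => g (n + N)%nat w - g n w)%C (fun w => x w - g (n + N)%nat w)%C);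
      auto.
    - apply holo_minus; [apply limit_holo | apply g_holo].
    - apply g_cauchy; assumption.
    - apply seg_le_bound with e; auto.
      + apply holo_minus; [apply limit_holo | apply g_holo].
      + intros y _. eapply Rle_trans; [apply x_lim; exact Hx |].
        change (K * A (n + N)%nat <= e). lra.
      + assert (e1 : e <= 1) by apply Rmin_l.
        assert (e2 : e <= PI * eta ^ 2 / (2 * T + 1)) by apply Rmin_r.
        apply Rle_trans with ((2 * T + 1) * e).
        { replace (e ^ 2) with (e * e) by ring. assert (e * e <= 1 * e) by (apply Rmult_le_compat_r; lra).
          assert (2 * T * (e * e) <= 2 * T * (1 * e)) by (apply Rmult_le_compat_l; lra). lra. }
        apply (Rmult_le_compat_l (2 * T + 1)) in e2; [| lra].
        replace ((2 * T + 1) * (PI * eta ^ 2 / (2 * T + 1))) with (PI * eta ^ 2) in e2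
          by (field; lra). exact e2. }
  unfold seg_le in *. apply le_epsilon. intros eps Heps. pose proof PI_RGT_0 as HPI.
  specialize (A_pos n).
  (* Chosen so that the excess [PI * (2 * A n + eta) * eta] of the squared bound is at most
     [eps]. *)
  set (eta := Rmin 1 (eps / (PI * (2 * A n + 1)))).
  assert (Q : 0 < PI * (2 * A n + 1)) by (apply Rmult_lt_0_compat; lra).
  assert (E0 : 0 < eta) by (apply Rmin_pos; [lra | apply Rdiv_lt_0_compat; assumption]).
  assert (E1 : eta <= 1) by apply Rmin_l.
  assert (E2 : eta <= eps / (PI * (2 * A n + 1))) by apply Rmin_r.
  eapply Rle_trans; [apply (Eta eta E0) |].
  apply (Rmult_le_compat_l _ _ _ (Rlt_le _ _ Q)) in E2.
  replace (PI * (2 * A n + 1) * (eps / (PI * (2 * A n + 1)))) with eps in E2 by (field; lra).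
  replace (PI * (A n + eta) ^ 2) with (PI * A n ^ 2 + PI * (2 * A n + eta) * eta) by ring.
  apply Rplus_le_compat_l. eapply Rle_trans; [| exact E2].
  apply Rmult_le_compat_r; [lra |]. apply Rmult_le_compat_l; lra.
Qed.

End Completeness.

Lemma h2_complete (g : nat -> C -> C) (A : nat -> R) :
  (forall n, holo (g n)) -> (forall n, 0 < A n) -> is_lim_seq A 0 ->
  (forall n m, h2le (fun w => g (n + m)%nat w - g n w)%C (A n)) ->
  exists x, holo x /\ forall n, h2le (fun w => x w - g n w)%C (A n).
Proof.
  intros Hg HA HL HC. destruct (h2_pointwise_limit g A Hg HA HL HC) as [x Hx].
  exists x. split.
  - eapply limit_holo; eauto.
  - intros n. eapply limit_h2le; eauto.
Qed.

(** * Shadowing for affine composition operators *)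

Lemma phi_aff_pair (a : R) (b : C) (x y : R) :
  phi_aff a b (x, y) = (a * x + Re b, a * y + Im b).
Proof. unfold phi_aff, Cplus, Cmult, RtoC, Re, Im; simpl. f_equal; ring. Qed.

Lemma Re_phi_aff_pos (a : R) (b w : C) : 0 < a -> 0 <= Re b -> 0 < Re w -> 0 < Re (phi_aff a b w).
Proof.
  intros Ha Hb Hw. destruct w as [x y]. rewrite phi_aff_pair. simpl Re in *.
  pose proof (Rmult_lt_0_compat a x Ha Hw). lra.
Qed.

Lemma holo_comp (a : R) (b : C) (f : C -> C) :
  0 < a -> 0 <= Re b -> holo f -> holo (Ccomp a b f).
Proof.
  intros Ha Hb Hf w Hw.
  destruct (Hf (phi_aff a b w) (Re_phi_aff_pos a b w Ha Hb Hw)) as [l Hl].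
  exists (l * (RtoC a * 1 + 0))%C. apply (cderiv_comp f (phi_aff a b)); [exact Hl |].
  apply cderiv_plus; [apply cderiv_scal, cderiv_id | apply cderiv_const].
Qed.

(** [phi] carries a vertical line to a vertical line and stretches it by [a]; the Jacobian [1 / a]
    of this change of variable becomes [1 / sqrt a] in the norm. *)
Lemma h2le_comp (a : R) (b : C) (f : C -> C) (A : R) :
  0 < a -> 0 <= Re b -> holo f -> h2le f A -> h2le (Ccomp a b f) (A * / sqrt a).
Proof.
  intros Ha Hb Hf H x T Hx HT. unfold seg_le.
  set (x' := a * x + Re b).
  assert (Hx' : 0 < x') by (pose proof (Rmult_lt_0_compat a x Ha Hx); unfold x'; lra).
  assert (E : a * RInt (sqmod (Ccomp a b f) x) (- T) T
    = RInt (sqmod f x') (a * (- T) + Im b) (a * T + Im b)).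
  { etransitivity; [| apply (RInt_comp_lin (V := R_CompleteNormedModule) (sqmod f x') a (Im b) (- T) T);
      apply sqmod_ex_RInt; assumption].
    etransitivity; [symmetry; apply (RInt_scal (V := R_CompleteNormedModule)
      (sqmod (Ccomp a b f) x) (- T) T a); apply sqmod_ex_RInt; [apply holo_comp |]; assumption |].
    apply (RInt_ext (V := R_CompleteNormedModule)). intros y _.
    unfold sqmod, Ccomp. rewrite phi_aff_pair. reflexivity. }
  assert (K : RInt (sqmod f x') (a * (- T) + Im b) (a * T + Im b) <= PI * A ^ 2).
  (* The image segment is off centre by [Im b], so it is enlarged to a symmetric one. *)
  { set (T' := a * T + Rabs (Im b)).
    pose proof (Rabs_pos (Im b)). pose proof (Rle_abs (Im b)).
    pose proof (Rle_abs (- Im b)) as K0. rewrite Rabs_Ropp in K0.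
    assert (0 <= a * T) by (apply Rmult_le_pos; lra).
    eapply Rle_trans; [| apply (H x' T' Hx'); unfold T'; lra].
    apply sqmod_RInt_mono; try assumption; unfold T'; lra. }
  rewrite Rpow_mult_distr, pow_inv, pow2_sqrt by lra.
  apply Rmult_le_reg_l with a; [exact Ha |]. rewrite E.
  replace (a * (PI * (A ^ 2 * / a))) with (PI * A ^ 2) by (field; lra). exact K.
Qed.

Lemma iter_Ccomp (a : R) (b : C) (n : nat) (f : C -> C) (w : C) :
  Nat.iter n (Ccomp a b) f w = f (Nat.iter n (phi_aff a b) w).
Proof.
  revert w. induction n as [| n IH]; intros w; [reflexivity |].
  rewrite (Nat.iter_succ_r n _ (phi_aff a b)). rewrite <- IH. reflexivity.
Qed.

Lemma holo_iter (a : R) (b : C) (n : nat) (f : C -> C) :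
  0 < a -> 0 <= Re b -> holo f -> holo (Nat.iter n (Ccomp a b) f).
Proof. intros Ha Hb Hf. induction n; [exact Hf | apply holo_comp; assumption]. Qed.

Lemma h2le_iter (a : R) (b : C) (n : nat) (f : C -> C) (A : R) :
  0 < a -> 0 <= Re b -> holo f -> h2le f A ->
  h2le (Nat.iter n (Ccomp a b) f) (A * (/ sqrt a) ^ n).
Proof.
  intros Ha Hb Hf H. induction n as [| n IH].
  - simpl. rewrite Rmult_1_r. exact H.
  - replace (A * (/ sqrt a) ^ S n) with (A * (/ sqrt a) ^ n * / sqrt a) by (simpl; ring).
    apply (h2le_comp a b (Nat.iter n (Ccomp a b) f)); auto using holo_iter.
Qed.

Lemma iter_cancel (X : Type) (p q : X -> X) (n : nat) (w : X) :
  (forall u, p (q u) = u) -> Nat.iter n p (Nat.iter n q w) = w.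
Proof.
  intros H. induction n as [| n IH]; [reflexivity |].
  rewrite (Nat.iter_succ_r n _ p). simpl. rewrite H. exact IH.
Qed.

Lemma h2_norm_diff_iff (f g : C -> C) (A : R) :
  holo f -> holo g -> 0 <= A ->
  (Rbar_le (h2_norm (fun w => f w - g w)%C) (Finite A) <-> h2le (fun w => f w - g w)%C A).
Proof. intros Hf Hg HA. apply h2_norm_le_iff; [apply holo_minus |]; assumption. Qed.

(** * The cases with shadowing *)

Lemma shadowing_contraction (a : R) (b : C) :
  1 < a -> 0 <= Re b -> H2_positive_shadowing (Ccomp a b).
Proof.
  intros Ha Hb eps Heps.
  assert (Ha0 : 0 < a) by lra.
  set (q := / sqrt a).
  assert (Hs : 1 < sqrt a) by (rewrite <- sqrt_1; apply sqrt_lt_1; lra).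
  assert (Hq0 : 0 < q) by (apply Rinv_0_lt_compat; lra).
  assert (Hq1 : q < 1) by (rewrite <- Rinv_1; apply Rinv_lt_contravar; lra).
  exists (eps * (1 - q)). split; [apply Rmult_lt_0_compat; lra |].
  intros xs Hxs Hps.
  assert (Hh : forall n, holo (xs n)) by (intros n; apply in_H2_iff, Hxs).
  exists (xs 0%nat). split; [apply Hxs |]. intros n.
  apply h2_norm_diff_iff; [apply holo_iter; auto | apply Hh | lra |].
  induction n as [| n IH].
  - apply (h2le_ext (fun _ => 0%C)); [intros w; simpl; ring |].
    apply h2le_weaken with 0; [lra | lra | apply h2le_zero].
  (* The new error is [T] applied to the old one plus the defect of the pseudotrajectory, of norms
     at most [q * eps] and [(1 - q) * eps]. *)
  - apply (h2le_ext (fun w => Ccomp a b (fun u => Nat.iter n (Ccomp a b) (xs 0%nat) u - xs n u) w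
      + (Ccomp a b (xs n) w - xs (S n) w))%C).
    { intros w. unfold Ccomp at 1. simpl. unfold Ccomp at 2 3. ring. }
    replace eps with (eps * q + eps * (1 - q)) by ring.
    assert (Hd : holo (fun u => Nat.iter n (Ccomp a b) (xs 0%nat) u - xs n u)%C)
      by (apply holo_minus; [apply holo_iter |]; auto).
    apply h2le_plus; try (apply Rmult_lt_0_compat; lra).
    + apply holo_comp; assumption.
    + apply holo_minus; [apply holo_comp |]; auto.
    + apply h2le_comp; assumption.
    + apply h2_norm_diff_iff; [apply holo_comp; auto | apply Hh | | apply Hps].
      apply Rmult_le_pos; lra.
Qed.

(* [x] is the limit of [T^-n x_n]; consecutive terms differ by at most [sqrt a ^ (n + 1) delta]. *)
Lemma shadowing_expansion (a : R) (b : C) :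
  0 < a < 1 -> Re b = 0 -> H2_positive_shadowing (Ccomp a b).
Proof.
  intros [Ha0 Ha1] Hb eps Heps.
  set (q := sqrt a).
  assert (Hq0 : 0 < q) by (apply sqrt_lt_R0, Ha0).
  assert (Hq1 : q < 1) by (unfold q; rewrite <- sqrt_1; apply sqrt_lt_1; lra).
  (* The inverse of [phi] is [w / a + c]. As [Re b = 0], also [Re c = 0], so the inverse preserves
     the half-plane. *)
  set (c := (- (b * RtoC (/ a)))%C).
  assert (Hc : Re c = 0).
  { unfold c. destruct b as [u v]. simpl in *. rewrite Hb. ring. }
  assert (Hia : 0 < / a) by (apply Rinv_0_lt_compat, Ha0).
  assert (Hqi : / sqrt (/ a) = q).
  { rewrite sqrt_inv, Rinv_inv. reflexivity. }
  assert (Na : RtoC a <> 0%C) by (intros E; apply RtoC_inj in E; lra).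
  assert (E1 : forall w, phi_aff a b (phi_aff (/ a) c w) = w).
  { intros w. unfold phi_aff, c. rewrite RtoC_inv by lra. field. exact Na. }
  assert (E2 : forall w, phi_aff (/ a) c (phi_aff a b w) = w).
  { intros w. unfold phi_aff, c. rewrite RtoC_inv by lra. field. exact Na. }
  set (delta := eps * (1 - q)).
  assert (Hdelta : 0 < delta) by (apply Rmult_lt_0_compat; lra).
  exists delta. split; [exact Hdelta |].
  intros xs Hxs Hps.
  assert (Hh : forall n, holo (xs n)) by (intros n; apply in_H2_iff, Hxs).
  assert (HbT : 0 <= Re b) by lra. assert (HcT : 0 <= Re c) by lra.
  set (g := fun n => Nat.iter n (Ccomp (/ a) c) (xs n)).
  assert (Hg : forall n, holo (g n)) by (intros n; apply holo_iter; auto).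
  (* The tail of the telescoping series is at most [delta * q^(n+1) / (1 - q) = eps * q^(n+1) <= A
     n]. In the end [T^n] multiplies norms by at most [q^(-n)], which turns [A n] into [eps]. *)
  set (A := fun n => eps * q ^ n).
  assert (HA : forall n, 0 < A n) by (intros n; apply Rmult_lt_0_compat; [| apply pow_lt]; lra).
  assert (HAl : is_lim_seq A 0).
  { assert (K := is_lim_seq_scal_l _ eps 0 (is_lim_seq_geom q ltac:(rewrite Rabs_right; lra))).
    replace (Rbar_mult eps 0) with (Finite 0) in K by (simpl; f_equal; ring). exact K. }
  (* [g (S n) - g n] is [T^-(n+1)] applied to [x_(n+1) - T x_n], and each inverse contributes a
     factor [q]. *)
  assert (Step : forall n, h2le (fun w => g (S n) w - g n w)%C (delta * q ^ S n)).
  { intros n.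
    assert (D : h2le (fun w => - (Ccomp a b (xs n) w - xs (S n) w))%C delta).
    { apply h2le_opp, h2_norm_diff_iff; [apply holo_comp; auto | auto | lra | apply Hps]. }
    apply (h2le_iter (/ a) c (S n)) in D; try assumption.
    - rewrite Hqi in D. revert D. apply h2le_ext. intros w.
      rewrite iter_Ccomp. unfold g. rewrite !iter_Ccomp. unfold Ccomp.
      simpl. rewrite E1. ring.
    - apply holo_opp, holo_minus; [apply holo_comp |]; auto. }
  assert (Hcauchy : forall m n, h2le (fun w => g (n + m)%nat w - g n w)%C (A n)).
  { induction m as [| m IH]; intros n.
    - rewrite Nat.add_0_r.
      apply (h2le_ext (fun _ => 0%C)); [intros w; ring |].
      specialize (HA n). apply h2le_weaken with 0; [lra | lra | apply h2le_zero].
    - apply (h2le_ext (fun w => (g (S n + m)%nat w - g (S n) w) + (g (S n) w - g n w))%C).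
      { intros w. replace (n + S m)%nat with (S n + m)%nat by lia. ring. }
      assert (P : 0 < q ^ n) by (apply pow_lt; lra).
      apply h2le_weaken with (A (S n) + delta * q ^ S n).
      + specialize (HA (S n)). pose proof (pow_lt q (S n) Hq0). nra.
      + unfold A, delta. simpl.
        assert (0 <= eps * q ^ n * (1 - q) ^ 2).
        { apply Rmult_le_pos; [apply Rlt_le, Rmult_lt_0_compat; lra | apply pow2_ge_0]. }
        apply Rminus_le_0.
        replace (_ - _) with (eps * q ^ n * (1 - q) ^ 2) by ring. assumption.
      + apply h2le_plus; auto using holo_minus.
        apply Rmult_lt_0_compat; [exact Hdelta | apply pow_lt, Hq0]. }
  destruct (h2_complete g A Hg HA HAl (fun n m => Hcauchy m n)) as [x [Hx1 Hx2]].
  exists x. split.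
  - apply in_H2_iff. split; [exact Hx1 |].
    destruct (proj1 (in_H2_iff _) (Hxs 0%nat)) as [_ [B [HB1 HB2]]].
    exists (A 0%nat + B). pose proof (HA 0%nat). split; [lra |].
    apply (h2le_ext (fun w => (x w - g 0%nat w) + xs 0%nat w)%C);
      [intros w; change (g 0%nat w) with (xs 0%nat w); ring |].
    apply h2le_plus; auto. apply holo_minus; auto.
  - intros n. apply h2_norm_diff_iff; [apply holo_iter; auto | apply Hh | lra |].
    assert (K := h2le_iter a b n _ _ Ha0 HbT (holo_minus _ _ Hx1 (Hg n)) (Hx2 n)).
    fold q in K.
    replace (A n * (/ q) ^ n) with eps in K.
    + revert K. apply h2le_ext. intros w. rewrite !iter_Ccomp.
      unfold g. rewrite iter_Ccomp, iter_cancel by exact E2. reflexivity.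
    + unfold A. rewrite pow_inv. field. apply pow_nonzero. lra.
Qed.

(** * Test functions [1 / (w + s)] and the cases without shadowing *)

Lemma kernel_holo (s : C) : 0 <= Re s -> holo (fun w => / (w + s))%C.
Proof.
  intros Hs w Hw. eexists. apply (cderiv_comp Cinv (fun u => u + s)%C).
  - apply cderiv_inv. intros E. apply (f_equal Re) in E. destruct w, s; simpl in *. lra.
  - apply cderiv_plus; [apply cderiv_id | apply cderiv_const].
Qed.

Lemma kernel_sqmod (s : C) (x y : R) :
  0 < x + Re s -> sqmod (fun w => / (w + s))%C x y = / ((x + Re s) ^ 2 + (y + Im s) ^ 2).
Proof.
  intros H. unfold sqmod. rewrite Cmod_inv.
  - rewrite pow_inv, Cmod2_alt. reflexivity.
  - intros E. apply (f_equal Re) in E. destruct s; simpl in *. lra.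
Qed.

Lemma kernel_h2le (s : C) : 1 <= Re s -> h2le (fun w => / (w + s))%C 1.
Proof.
  intros Hs x T Hx HT. unfold seg_le.
  set (p := x + Re s). assert (Hp : 1 < p) by (unfold p; lra).
  (* An arctangent varies by less than [PI], so the integral is below [PI / p < PI]. *)
  assert (I : is_RInt (fun y => / (p ^ 2 + (y + Im s) ^ 2)) (- T) T
    (minus (atan ((T + Im s) / p) / p) (atan ((- T + Im s) / p) / p))).
  { apply (is_RInt_derive (V := R_CompleteNormedModule) (fun y => atan ((y + Im s) / p) / p)).
    - intros y _. assert (0 < p ^ 2 + (y + Im s) ^ 2).
      { pose proof (pow2_ge_0 (y + Im s)). assert (0 < p ^ 2) by (apply pow_lt; lra). lra. }
      auto_derive; [lra |]. unfold Rsqr. field. split; [| lra].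
      replace (p * p + (y + Im s) * (y + Im s)) with (p ^ 2 + (y + Im s) ^ 2) by ring. lra.
    - intros y _. apply (ex_derive_continuous (K := R_AbsRing) (V := R_NormedModule)).
      assert (0 < p ^ 2 + (y + Im s) ^ 2).
      { pose proof (pow2_ge_0 (y + Im s)). assert (0 < p ^ 2) by (apply pow_lt; lra). lra. }
      auto_derive. simpl in *. lra. }
  rewrite (RInt_ext (V := R_CompleteNormedModule) _ (fun y => / (p ^ 2 + (y + Im s) ^ 2))).
  2:{ intros y _. apply kernel_sqmod. fold p. lra. }
  rewrite (is_RInt_unique (V := R_CompleteNormedModule) _ _ _ _ I).
  unfold minus, plus, opp; simpl.
  pose proof (atan_bound ((T + Im s) / p)). pose proof (atan_bound ((- T + Im s) / p)).
  pose proof PI_RGT_0.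
  apply Rmult_le_reg_r with p; [lra |].
  replace ((atan ((T + Im s) / p) / p + - (atan ((- T + Im s) / p) / p)) * p)
    with (atan ((T + Im s) / p) - atan ((- T + Im s) / p)) by (field; lra).
  nra.
Qed.

(** Turns largeness on a single segment into a lower bound for the norm; both counterexamples end
    with it. *)
Lemma seg_lower_bound (f : C -> C) (x T A M : R) :
  holo f -> 0 < x -> 0 <= T -> 0 <= M -> (forall y, - T <= y <= T -> M <= Cmod (f (x, y))) ->
  h2le f A -> 2 * T * M ^ 2 <= PI * A ^ 2.
Proof.
  intros Hf Hx HT HM HL HA. eapply Rle_trans; [| apply (HA x T Hx HT)].
  replace (2 * T * M ^ 2) with (RInt (fun _ => M ^ 2) (- T) T)
    by (rewrite (RInt_const (V := R_CompleteNormedModule)); unfold scal; simpl; unfold mult; simpl; ring).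
  apply RInt_le; [lra | apply ex_RInt_const | apply sqmod_ex_RInt; assumption |].
  intros y Hy. unfold sqmod. apply pow_incr. split; [exact HM | apply HL; lra].
Qed.

(* [x_n = n delta T^n f] with [f w = 1 / (w + 1)]: [||T^n f||] only decays like
   [1 / sqrt n], so [x_n] is unbounded whereas [T^n x] is bounded. *)
Lemma no_shadowing_parabolic (b : C) : 0 <= Re b -> ~ H2_positive_shadowing (Ccomp 1 b).
Proof.
  intros Hb Hsh. destruct (Hsh 1 Rlt_0_1) as [delta [Hd Hsh']]. clear Hsh.
  (* [T^n f] is again a kernel, [1 / (w + s n)], because [phi] iterates to [w + n b]. *)
  set (s := fun n : nat => (1 + RtoC (INR n) * b)%C).
  assert (Hs : forall n, 1 <= Re (s n)).
  { intros n. unfold s. destruct b as [u v]. simpl in *. pose proof (pos_INR n).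
    assert (0 <= INR n * u) by (apply Rmult_le_pos; assumption). lra. }
  set (xs := fun (n : nat) (w : C) => (RtoC (delta * INR n) * / (w + s n))%C).
  assert (HK : forall n, holo (fun w => / (w + s n))%C).
  { intros n. apply kernel_holo. specialize (Hs n). lra. }
  assert (Hxs : forall n, holo (xs n)) by (intros n; apply holo_scal, HK).
  assert (HxsH : forall n, in_H2 (xs n)).
  { intros n. apply in_H2_iff. split; [apply Hxs |].
    exists (delta * INR n + 1).
    assert (0 <= delta * INR n) by (apply Rmult_le_pos; [lra | apply pos_INR]).
    split; [lra |].
    apply h2le_weaken with (Cmod (RtoC (delta * INR n)) * 1).
    - rewrite Rmult_1_r. apply Cmod_ge_0.
    - rewrite Cmod_R, Rabs_right; lra.
    - apply h2le_scal; [apply HK | apply kernel_h2le, Hs]. }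
  destruct (Hsh' xs HxsH) as [x [Hx Hshx]].
  { intros n. apply h2_norm_diff_iff; [apply holo_comp; auto; lra | apply Hxs | lra |].
    apply (h2le_ext (fun w => RtoC (- delta) * / (w + s (S n)))%C).
    - intros w. unfold Ccomp, xs.
      replace (phi_aff 1 b w + s n)%C with (w + s (S n))%C.
      + rewrite S_INR, Rmult_plus_distr_l, Rmult_1_r, RtoC_plus, RtoC_opp. ring.
      + unfold s, phi_aff. rewrite S_INR, RtoC_plus. ring.
    - apply h2le_weaken with (Cmod (RtoC (- delta)) * 1).
      + rewrite Rmult_1_r. apply Cmod_ge_0.
      + rewrite Cmod_R, Rabs_Ropp, Rabs_right; lra.
      + apply h2le_scal; [apply HK | apply kernel_h2le, Hs]. }
  apply in_H2_iff in Hx. destruct Hx as [Hx [A [HA1 HA2]]].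
  assert (HT : forall n, holo (Nat.iter n (Ccomp 1 b) x)) by (intros n; apply holo_iter; auto; lra).
  assert (Bnd : forall n, h2le (xs n) (A + 1)).
  { intros n.
    assert (K1 := h2le_iter 1 b n x A Rlt_0_1 Hb Hx HA2).
    rewrite sqrt_1, Rinv_1, pow1, Rmult_1_r in K1.
    assert (K2 := proj1 (h2_norm_diff_iff _ _ 1 (HT n) (Hxs n) Rle_0_1) (Hshx n)).
    apply h2le_opp in K2.
    apply (h2le_ext (fun w => Nat.iter n (Ccomp 1 b) x w
        + - (Nat.iter n (Ccomp 1 b) x w - xs n w))%C); [intros w; ring |].
    apply h2le_plus; auto; [| lra].
    apply holo_opp, holo_minus; auto. }
  (* For [n >= 1] and [|y| <= n], [1 + i y + s n] has real part at most [n * (2 + Re b)] and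
     imaginary part at most [n * (1 + |Im b|)] in absolute value, so its modulus is at most
     [n * sqrt Q]. *)
  set (Q := (2 + Re b) ^ 2 + (1 + Rabs (Im b)) ^ 2).
  pose proof (Rabs_pos (Im b)) as Hg.
  assert (HQ : 1 <= Q).
  { unfold Q. pose proof (pow2_ge_0 (1 + Rabs (Im b))). nra. }
  (* On a segment of length [2 n] the factor [n] of [x_n] cancels the decay of the kernel, leaving
     [|x_n| >= delta / sqrt Q]: the left side grows linearly, the right side is fixed. *)
  assert (Low : forall n, (1 <= n)%nat -> 2 * INR n * (delta / sqrt Q) ^ 2 <= PI * (A + 1) ^ 2).
  { intros n Hn. assert (Hn1 : 1 <= INR n) by (apply (le_INR 1 n), Hn).
    apply (seg_lower_bound (xs n) 1 (INR n) (A + 1)); auto; try lra.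
    - apply Rlt_le, Rdiv_lt_0_compat; [exact Hd | apply sqrt_lt_R0; lra].
    - intros y Hy. unfold xs. rewrite Cmod_mult, Cmod_R, Rabs_right by nra.
      assert (Ns : ((1, y) + s n)%C <> 0%C).
      { intros E. apply (f_equal Re) in E. specialize (Hs n). destruct (s n); simpl in *. lra. }
      rewrite Cmod_inv by exact Ns.
      assert (Pm : 0 < Cmod ((1, y) + s n)) by (apply Cmod_gt_0, Ns).
      assert (Up : Cmod ((1, y) + s n) <= INR n * sqrt Q).
      { rewrite <- (sqrt_pow2 (INR n)) by lra. rewrite <- sqrt_mult by (try apply pow2_ge_0; lra).
        rewrite <- (sqrt_pow2 (Cmod ((1, y) + s n))) by lra.
        apply sqrt_le_1_alt. rewrite Cmod2_alt. unfold Q, s. rewrite Rmult_plus_distr_l.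
        destruct b as [u v]. simpl Re in *. simpl Im in *.
        rewrite <- !Rpow_mult_distr.
        apply Rplus_le_compat.
        - simpl Re. apply pow_incr. split; [| nra]. simpl. nra.
        - match goal with |- ?t ^ 2 <= _ => rewrite <- (pow2_abs t) end. apply pow_incr. split; [apply Rabs_pos |].
          apply Rle_trans with (Rabs y + INR n * Rabs v).
          + simpl. replace (y + _) with (y + INR n * v) by ring.
            eapply Rle_trans; [apply Rabs_triang |].
            rewrite Rabs_mult, (Rabs_right (INR n)) by lra. lra.
          + assert (Rabs y <= INR n) by (apply Rabs_le; lra). lra. }
      assert (SQ : 0 < sqrt Q) by (apply sqrt_lt_R0; lra).
      apply Rmult_le_reg_r with (Cmod ((1, y) + s n)); [exact Pm |].
      rewrite (Rmult_assoc _ (/ _)), Rinv_l, Rmult_1_r by lra.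
      apply Rle_trans with (delta / sqrt Q * (INR n * sqrt Q)).
      + apply Rmult_le_compat_l; [apply Rlt_le, Rdiv_lt_0_compat; lra | exact Up].
      + right. field. lra. }
  set (k := (delta / sqrt Q) ^ 2) in *.
  assert (Hk : 0 < k) by (apply pow_lt, Rdiv_lt_0_compat; [| apply sqrt_lt_R0]; lra).
  destruct (INR_unbounded (PI * (A + 1) ^ 2 / k)) as [N HN].
  specialize (Low (S N) ltac:(lia)). rewrite S_INR in Low. pose proof (pos_INR N) as PN.
  apply (Rmult_lt_compat_r k) in HN; [| exact Hk].
  unfold Rdiv in HN. rewrite Rmult_assoc, Rinv_l, Rmult_1_r in HN by lra. nra.
Qed.

(* The map contracts towards its fixed point [w0 = b / (1 - a)], hence [T^n x] stays
   bounded on a vertical segment around [w0], whereas the pseudotrajectory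
   [x_n = delta * sum_(k < n) T^k f] grows linearly there. *)
Lemma no_shadowing_interior_fixed_point (a : R) (b : C) :
  0 < a < 1 -> 0 < Re b -> ~ H2_positive_shadowing (Ccomp a b).
Proof.
  intros [Ha0 Ha1] Hb0 Hsh. assert (Hb : 0 <= Re b) by lra.
  destruct (Hsh 1 Rlt_0_1) as [delta [Hd Hsh']]. clear Hsh.
  set (u0 := Re b / (1 - a)). set (v0 := Im b / (1 - a)).
  assert (Hu0 : 0 < u0) by (apply Rdiv_lt_0_compat; lra).
  (* Large enough for the segment around [v0] to contain [[-1, 1]], since the norm integrates over
     segments centred at height 0. *)
  set (L := Rabs v0 + 1). pose proof (Rabs_pos v0) as Hv0.
  assert (Seg : forall v, Rabs (v - v0) <= L ->
    exists v', phi_aff a b (u0, v) = (u0, v') /\ Rabs (v' - v0) <= L).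
  { intros v Hv. exists (a * v + Im b). rewrite phi_aff_pair. split.
    - f_equal. unfold u0. field. lra.
    - replace (a * v + Im b - v0) with (a * (v - v0)) by (unfold v0; field; lra).
      rewrite Rabs_mult, (Rabs_right a) by lra. pose proof (Rabs_pos (v - v0)). nra. }
  (* The kernel is centred at the height of the fixed point, so that its real part on the segment is
     positive and at least [m]; the contributions to [x_n] then add up without cancellation. *)
  set (s := (1, - v0) : C).
  set (f := fun w => (/ (w + s))%C).
  assert (Hf : holo f) by (apply kernel_holo; simpl; lra).
  assert (Hf1 : h2le f 1) by (apply kernel_h2le; simpl; lra).
  set (df := fun w => (RtoC delta * f w)%C).
  assert (Hdf : holo df) by (apply holo_scal, Hf).
  assert (Hdf1 : h2le df delta).
  { pose proof (h2le_scal (RtoC delta) f 1 Hf Hf1) as K.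
    rewrite Cmod_R, Rabs_right, Rmult_1_r in K by lra. exact K. }
  (* The sum in recursive form, [x_(n+1) = T x_n + delta f]; the defect is then exactly
     [- delta f]. *)
  set (xs := nat_rect (fun _ => C -> C) (fun _ => 0%C)
    (fun _ h w => (Ccomp a b h w + df w)%C)).
  assert (Hxs : forall n, holo (xs n) /\ exists A, 0 < A /\ h2le (xs n) A).
  { induction n as [| n [IH1 [A [HA1 HA2]]]].
    - split; [intros w _; exists 0%C; apply cderiv_const |].
      exists 1. split; [lra |]. apply h2le_weaken with 0; [lra | lra | apply h2le_zero].
    - split; [apply holo_plus; [apply holo_comp; assumption | exact Hdf] |].
      assert (0 < A * / sqrt a).
      { apply Rmult_lt_0_compat; [exact HA1 | apply Rinv_0_lt_compat, sqrt_lt_R0, Ha0]. }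
      exists (A * / sqrt a + delta). split; [lra |].
      apply (h2le_plus (Ccomp a b (xs n)) df); auto using holo_comp, h2le_comp. }
  destruct (Hsh' xs) as [x [Hx Hshx]].
  { intros n. apply in_H2_iff, Hxs. }
  { intros n. apply h2_norm_diff_iff; [apply holo_comp; auto; apply Hxs | apply Hxs | lra |].
    apply (h2le_ext (fun w => - df w)%C); [intros w; simpl; ring |].
    apply h2le_opp, Hdf1. }
  apply in_H2_iff in Hx. destruct Hx as [Hx _].
  set (m := (u0 + 1) / ((u0 + 1) ^ 2 + L ^ 2)).
  assert (Hden : 0 < (u0 + 1) ^ 2 + L ^ 2) by (pose proof (pow2_ge_0 L); nra).
  assert (Hm : 0 < m) by (apply Rdiv_lt_0_compat; lra).
  assert (Rf : forall v, Rabs (v - v0) <= L -> m <= Re (f (u0, v))).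
  { intros v Hv. unfold f, s, m.
    replace (Re (/ ((u0, v) + (1, - v0)))) with ((u0 + 1) / ((u0 + 1) ^ 2 + (v - v0) ^ 2))
      by reflexivity.
    unfold Rdiv. apply Rmult_le_compat_l; [lra |].
    apply Rinv_le_contravar; [pose proof (pow2_ge_0 (v - v0)); nra |].
    apply Rplus_le_compat_l. rewrite <- (pow2_abs (v - v0)). apply pow_incr.
    split; [apply Rabs_pos | exact Hv]. }
  assert (Rx : forall n v, Rabs (v - v0) <= L -> INR n * (delta * m) <= Re (xs n (u0, v))).
  { induction n as [| n IH]; intros v Hv; [simpl; lra |].
    rewrite S_INR. destruct (Seg v Hv) as [v' [E Hv']].
    specialize (IH v' Hv'). specialize (Rf v Hv).
    replace (Re (xs (S n) (u0, v))) with (Re (xs n (u0, v')) + delta * Re (f (u0, v))).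
    - nra.
    - change (xs (S n) (u0, v)) with (xs n (phi_aff a b (u0, v)) + df (u0, v))%C.
      rewrite E. unfold df. destruct (xs n (u0, v')), (f (u0, v)). simpl. ring. }
  assert (Seg_iter : forall n v, Rabs (v - v0) <= L ->
    exists v', Nat.iter n (phi_aff a b) (u0, v) = (u0, v') /\ Rabs (v' - v0) <= L).
  { induction n as [| n IH]; intros v Hv; [exists v; auto |].
    destruct (IH v Hv) as [v1 [E1 H1]]. destruct (Seg v1 H1) as [v2 [E2 H2]].
    exists v2. simpl. rewrite E1. auto. }
  (* On the invariant segment the whole orbit of [x] only takes values of [x] on that compact set.
     [M] bounds [|x|^2], and [|x| <= 1 + |x|^2]. *)
  destruct (bounded_continuity (V := R_NormedModule) (sqmod x u0) (v0 - L) (v0 + L)) as [M HM].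
  { intros v _. apply sqmod_cont; assumption. }
  assert (Bx : forall n v, Rabs (v - v0) <= L ->
    Re (Nat.iter n (Ccomp a b) x (u0, v)) <= 1 + M).
  { intros n v Hv. rewrite iter_Ccomp. destruct (Seg_iter n v Hv) as [v' [-> Hv']].
    apply Rabs_le_between in Hv'. specialize (HM v' ltac:(lra)).
    change (Rabs (sqmod x u0 v') < M) in HM. rewrite Rabs_right in HM by (apply Rle_ge, sqmod_pos).
    unfold sqmod in HM. pose proof (Cmod_ge_0 (x (u0, v'))).
    eapply Rle_trans; [apply Rle_abs |]. eapply Rle_trans; [apply re_le_Cmod |].
    pose proof (pow2_ge_0 (Cmod (x (u0, v')) - 1)). nra. }
  assert (Hdm : 0 < delta * m) by (apply Rmult_lt_0_compat; assumption).
  (* [Re x_N > 5 + M] against [Re T^N x <= 1 + M] leaves a gap of 4 on [[-1, 1]]. Norm at most 1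
     would then give [2 * 4^2 <= PI]. *)
  destruct (INR_unbounded ((5 + M) / (delta * m))) as [N HN].
  apply (Rmult_lt_compat_r (delta * m)) in HN; [| exact Hdm].
  unfold Rdiv in HN. rewrite Rmult_assoc, Rinv_l, Rmult_1_r in HN by lra.
  assert (HT : holo (Nat.iter N (Ccomp a b) x)) by (apply holo_iter; assumption).
  assert (K := proj1 (h2_norm_diff_iff _ _ 1 HT (proj1 (Hxs N)) Rle_0_1) (Hshx N)).
  apply (seg_lower_bound _ u0 1 1 4) in K; try lra; [pose proof PI_4; lra | apply holo_minus; [exact HT | apply Hxs] |].
  intros y Hy.
  assert (Hv : Rabs (y - v0) <= L).
  { unfold L. eapply Rle_trans; [apply Rabs_triang |]. rewrite Rabs_Ropp.
    assert (Rabs y <= 1) by (apply Rabs_le; lra). lra. }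
  specialize (Rx N y Hv). specialize (Bx N y Hv).
  eapply Rle_trans; [| apply re_le_Cmod].
  eapply Rle_trans; [| rewrite <- Rabs_Ropp; apply Rle_abs].
  destruct (Nat.iter N (Ccomp a b) x (u0, y)), (xs N (u0, y)). simpl in *. lra.
Qed.

Theorem theorem4p2 (a : R) (b : C) (ha : 0 < a) (hb : 0 <= Re b) :
  (((a <> 1 /\ Re b = 0) \/ (1 < a /\ 0 < Re b)) ->
     H2_positive_shadowing (Ccomp a b)) /\
  ((a = 1 \/ (a < 1 /\ 0 < Re b)) ->
     ~ H2_positive_shadowing (Ccomp a b)).
Proof.
  split.
  (* The split is by the size of [a], since the contraction argument covers [a > 1] in both
     hyperbolic types. *)
  - intros H. destruct (Rlt_dec 1 a) as [H1 | H1].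
    + apply shadowing_contraction; assumption.
    + destruct H as [[Ha Hb] | [Ha _]]; [| lra].
      apply shadowing_expansion; [lra | exact Hb].
  - intros [-> | [Ha Hb]].
    + apply no_shadowing_parabolic, hb.
    + apply no_shadowing_interior_fixed_point; [lra | exact Hb].
Qed.
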